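(* Let $X$ and $Y$ be Banach spaces and let $\Omega$ be a compact Hausdorff space with Borel $\sigma$-algebra $\Sigma$. (a) Every operator $S\in\mathcal{L}(\mathcal{C}(\Omega),\mathcal{L}(X,Y))$ has a unique representing measure $m:\Sigma\to\mathcal{L}(X,Y^{**})$. (b) Assume that $m:\Sigma\to\mathcal{L}(X,Y^{**})$ is a bounded vector measure. Then there exists an operator $S\in\mathcal{L}(\mathcal{C}(\Omega),\mathcal{L}(X,Y))$ such that $m$ is its representing measure if and only if for all $x\in X$, $$\mu_{x,y^*}=\langle y^*,m_x(\cdot)\rangle\in\mathcal{C}(\Omega)^*,\quad y^*\in Y^*,$$ and the map $Y^*\to\mathcal{C}(\Omega)^*$, $y^*\mapsto\langle y^*,m_x(\cdot)\rangle$, is linear, bounded, and weak*-to-weak* continuous. In this case, $m_x:\Sigma\to Y^{**}$ is the representing measure of the operator $S_x\in\mathcal{L}(\mathcal{C}(\Omega),Y)$ and $\mu_{x,y^*}=S_x^*y^*$ for all $x\in X$ and $y^*\in Y^*$, the equality $\|S\|=\|m\|(\Omega)$ holds, and the measure $m:\Sigma\to\mathcal{L}(X,Y^{**})=(X\hat{\otimes}_\pi Y^* )^*$ is weak*-countably additive, i.e. $\langle u,m(\bigcup_{n=1}^\infty E_n)\rangle=\sum_{n=1}^\infty\langle u,m(E_n)\rangle$ for every $u\in X\hat{\otimes}_\pi Y^*$ and every sequence $(E_n)$ of pairwise disjoint members of $\Sigma$.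
   Context: Banach spaces are over the same field $\mathbb{K}$ ($\mathbb{R}$ or $\mathbb{C}$); a Banach space is regarded as a subspace of its bidual, so $\mathcal{L}(X,Y)\subset\mathcal{L}(X,Y^{**})$, where $\mathcal{L}$ denotes bounded linear operators. $\mathcal{C}(\Omega)$ is the space of continuous scalar functions on $\Omega$ with the sup norm; $\mathcal{C}(\Omega)^*$ is identified with the space of regular countably additive scalar Borel measures on $\Omega$. $\mathcal{B}(\Sigma)$ is the Banach space of uniform limits of sequences of $\Sigma$-simple scalar functions (sup norm). A vector measure $m:\Sigma\to Z$ ($Z$ a Banach space) is a finitely additive set function. Its semivariation is $\|m\|(\Omega)=\sup\|\sum_{i=1}^n\varepsilon_i m(E_i)\|$ over all finite partitions $(E_i)_{i=1}^n\subset\Sigma$ of $\Omega$ and scalars $|\varepsilon_i|\le1$; $m$ is bounded if $\|m\|(\Omega)<\infty$ (equivalently, its range is bounded). For bounded $m$, $\int_\Omega\varphi\,dm$ is defined for $\varphi\in\mathcal{B}(\Sigma)$ by $\int_\Omega\chi_E\,dm=m(E)$, linearity, and density. For a bounded vector measure $m:\Sigma\to\mathcal{L}(X,Y^{**})$, $x\in X$, $y^*\in Y^*$, put $m_x(E)=m(E)x\in Y^{**}$ and $\mu_{x,y^*}(E)=\langle y^*,m(E)x\rangle$, $E\in\Sigma$. A representing measure of $S\in\mathcal{L}(\mathcal{C}(\Omega),\mathcal{L}(X,Y))$ is a bounded vector measure $m:\Sigma\to\mathcal{L}(X,Y^{**})$ which satisfies $S\varphi=\int_\Omega\varphi\,dm$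 for all $\varphi\in\mathcal{C}(\Omega)$. For $x\in X$, $S_x\in\mathcal{L}(\mathcal{C}(\Omega),Y)$ is defined by $S_x\varphi=(S\varphi)x$. By the Bartle--Dunford--Schwartz theorem, for every operator $T\in\mathcal{L}(\mathcal{C}(\Omega),Z)$ there exists a unique bounded vector measure $G:\Sigma\to Z^{**}$ such that $T\varphi=\int_\Omega\varphi\,dG$ for all $\varphi\in\mathcal{C}(\Omega)$; $G$ is called the (classical) representing measure of $T$. The identification $\mathcal{L}(X,Y^{**})=(X\hat{\otimes}_\pi Y^* )^*$ ($\pi$ the projective tensor norm) is given by $\langle x\otimes y^*,A\rangle=\langle y^*,Ax\rangle$.
   Formalization: Representing measures (of S and of S_x) are also required to be weak*-regular, i.e. every scalar set function μ_{x,y*} is regular; for merely finitely additive bounded measures, uniqueness in (a) and the ''only if'' in (b) are false. *)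

(* Defs.v *)
From HB Require Import structures.
From mathcomp Require Import all_boot all_order all_algebra.
From mathcomp Require Import complex.
From mathcomp Require Import all_classical all_reals all_analysis.

Set Implicit Arguments.
Unset Strict Implicit.
Unset Printing Implicit Defensive.

Import Order.TTheory GRing.Theory Num.Theory.
Import numFieldNormedType.Exports.

Local Open Scope classical_set_scope.
Local Open Scope ring_scope.

Variant scalar_kind := RealScalars | ComplexScalars.

Definition scalars (R : realType) (k : scalar_kind) : numFieldType :=
  match k with
  | RealScalars => R : numFieldType
  | ComplexScalars => R[i] : numFieldType
  end.

(* MathComp norms are valued in the scalar field itself. toR reads a scalar as
   a real number (the real part in the complex case), and is used only on
   norms; ofR is the inclusion of R in the scalar field. *)
Definition toR {R : realType} {k : scalar_kind} : scalars R k -> R :=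
  match k with
  | RealScalars => fun x => x
  | ComplexScalars => fun z => complex.Re z
  end.

Definition ofR {R : realType} {k : scalar_kind} : R -> scalars R k :=
  match k with
  | RealScalars => fun x => x
  | ComplexScalars => fun x => (x%:C)%C
  end.

Section scalars_theory.
Context {R : realType} {k : scalar_kind}.
Local Notation K := (scalars R k).

Lemma ofRK : cancel (@ofR R k) toR.
Proof. by case: k. Qed.

Lemma toRK (x : K) : 0 <= x -> ofR (toR x) = x.
Proof. by case: k x => //= -[a b]; rewrite lecE /= => /andP[/eqP -> _]. Qed.

Lemma ofRD (x y : R) : ofR (x + y) = ofR x + ofR y :> K.
Proof. by case: k => //=; rewrite rmorphD. Qed.

Lemma ofRM (x y : R) : ofR (x * y) = ofR x * ofR y :> K.
Proof. by case: k => //=; rewrite rmorphM. Qed.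

Lemma ler_ofR (x y : R) : (ofR x <= ofR y :> K) = (x <= y).
Proof. by case: k => //=; rewrite lecR. Qed.

Lemma ofR0 : ofR 0 = 0 :> K.
Proof. by case: k. Qed.

Lemma ofR1 : ofR 1 = 1 :> K.
Proof. by case: k. Qed.

End scalars_theory.

Section real_norm.
Context {R : realType} {k : scalar_kind}.
Local Notation K := (scalars R k).

Definition rnorm {V : normedModType K} (v : V) : R := toR `|v|.

Lemma ofR_rnorm {V : normedModType K} (v : V) : ofR (rnorm v) = `|v|.
Proof. exact/toRK/normr_ge0. Qed.

Variable V : normedModType K.
Implicit Types u v : V.

Lemma rnorm_ge0 v : 0 <= rnorm v.
Proof. by rewrite -(@ler_ofR R k) ofR_rnorm ofR0 normr_ge0. Qed.

Lemma rnormD u v : rnorm (u + v) <= rnorm u + rnorm v.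
Proof. by rewrite -(@ler_ofR R k) ofRD !ofR_rnorm ler_normD. Qed.

Lemma rnormZ (l : K) v : rnorm (l *: v) = rnorm (l : K^o) * rnorm v.
Proof.
apply: (can_inj (@ofRK R k)).
by rewrite ofRM !ofR_rnorm normrZ.
Qed.

Lemma rnorm0 : rnorm (0 : V) = 0.
Proof. by apply: (can_inj (@ofRK R k)); rewrite ofR_rnorm normr0 ofR0. Qed.

Lemma rnorm0_eq0 v : rnorm v = 0 -> v = 0.
Proof. by move=> v0; apply/normr0_eq0; rewrite -ofR_rnorm v0 ofR0. Qed.

End real_norm.


Section sup_norm.
Context {R : realType} {k : scalar_kind}.
Local Notation K := (scalars R k).
Context {I : Type} {V : normedModType K}.

Definition sup_norm (A : set I) (f : I -> V) : K :=
  ofR (sup [set rnorm (f i) | i in A]).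

Definition norm_bounded_on (A : set I) (f : I -> V) : Prop :=
  exists M : R, forall i, A i -> rnorm (f i) <= M.

Variable A : set I.
Implicit Types f g : I -> V.

Lemma sup_norm_ub f i : norm_bounded_on A f -> A i -> `|f i| <= sup_norm A f.
Proof.
move=> [M fM] Ai; rewrite -ofR_rnorm ler_ofR; apply: ub_le_sup; last by exists i.
by exists M => _ [j Aj <-]; exact: fM.
Qed.

Lemma sup_norm_ge0 f : 0 <= sup_norm A f.
Proof.
rewrite -(@ofR0 R k) ler_ofR; set B := (X in sup X).
have [[[_ [i Ai _]] ubB]|/sup_out ->//] := pselect (has_sup B).
by apply: (le_trans (rnorm_ge0 (f i))); apply: ub_le_sup => //; exists i.
Qed.

Lemma sup_norm_le f (M : K) :
  0 <= M -> (forall i, A i -> `|f i| <= M) -> sup_norm A f <= M.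
Proof.
move=> M0 fM; rewrite -(toRK M0) ler_ofR.
have [->|A0] := eqVneq A set0.
  by rewrite image_set0 sup0 -(@ler_ofR R k) ofR0 toRK.
apply: ge_sup; first by have /set0P[i Ai] := A0; exists (rnorm (f i)), i.
by move=> _ [i Ai <-]; rewrite -(@ler_ofR R k) ofR_rnorm toRK// fM.
Qed.

Lemma sup_normD f g : norm_bounded_on A f -> norm_bounded_on A g ->
  sup_norm A (f \+ g) <= sup_norm A f + sup_norm A g.
Proof.
move=> bf bg; apply: sup_norm_le; first by rewrite addr_ge0// sup_norm_ge0.
move=> i Ai /=; apply: (le_trans (ler_normD _ _)).
by rewrite lerD// sup_norm_ub.
Qed.

Lemma sup_normZ (l : K) f : norm_bounded_on A f ->
  sup_norm A (fun i => l *: f i) = `|l| * sup_norm A f.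
Proof.
move=> bf; apply/eqP; rewrite eq_le; apply/andP; split.
  apply: sup_norm_le => [|i Ai]; first by rewrite mulr_ge0// sup_norm_ge0.
  by rewrite normrZ ler_wpM2l// sup_norm_ub.
have [->|l0] := eqVneq l 0; first by rewrite normr0 mul0r sup_norm_ge0.
have nl0 : 0 < `|l| by rewrite normr_gt0.
rewrite -ler_pdivlMl//; apply: sup_norm_le => [|i Ai].
  by rewrite mulr_ge0// ?invr_ge0// sup_norm_ge0.
rewrite ler_pdivlMl// -normrZ.
apply: (@sup_norm_ub (fun i => l *: f i)) => //.
case: bf => M fM; exists (rnorm (l : K^o) * M) => j Aj.
by rewrite rnormZ ler_wpM2l ?rnorm_ge0// fM.
Qed.

Lemma sup_norm_eq0 f i :
  norm_bounded_on A f -> sup_norm A f = 0 -> A i -> f i = 0.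
Proof.
move=> bf f0 Ai; apply/normr0_eq0/eqP.
by rewrite eq_le normr_ge0 andbT -f0 sup_norm_ub.
Qed.

End sup_norm.

Section bounded_operators.
Context {R : realType} {k : scalar_kind}.
Local Notation K := (scalars R k).
Variables V W : normedModType K.

Definition bounded_linear : {pred V -> W} :=
  [pred f | `[< linear f /\ exists M : R, forall x, rnorm (f x) <= M * rnorm x >]].

Record blin := Blin {
  blin_fun :> V -> W;
  _ : blin_fun \in bounded_linear }.

HB.instance Definition _ := [isSub for blin_fun].
HB.instance Definition _ := [Choice of blin by <:].

Lemma bounded_linear_submod : submod_closed bounded_linear.
Proof.
split.
  apply/asboolP; split=> [l x y|]; first by rewrite /= scaler0 addr0.
  by exists 0 => x; rewrite mul0r rnorm0.
move=> l f g /asboolP[lf [M fM]] /asboolP[lg [N gN]]; apply/asboolP; split.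
  move=> a x y.
  rewrite !fctE lf lg !scalerDr !scalerA addrACA; congr (_ + _).
  by rewrite mulrC.
exists (rnorm (l : K^o) * M + N) => x; rewrite !fctE.
apply: (le_trans (rnormD _ _)); rewrite mulrDl lerD// rnormZ -mulrA.
by rewrite ler_wpM2l ?rnorm_ge0.
Qed.
HB.instance Definition _ :=
  GRing.isSubmodClosed.Build K (V -> W) bounded_linear bounded_linear_submod.
HB.instance Definition _ := [SubChoice_isSubLmodule of blin by <:].

Implicit Types f g : blin.

Lemma blin_linear f : linear f.
Proof. by have /asboolP[] := valP f. Qed.

HB.instance Definition _ f := GRing.isLinear.Build K V W *:%R f (blin_linear f).

Lemma blin_bounded f : norm_bounded_on [set x | `|x| <= 1] f.
Proof.
have /asboolP[_ [M fM]] := valP f; exists (Num.max M 0) => x /= x1.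
apply: (le_trans (fM x)); apply: (@le_trans _ _ (Num.max M 0 * rnorm x)).
  by rewrite ler_wpM2r ?rnorm_ge0// le_max lexx.
rewrite ler_piMr// ?le_max ?lexx ?orbT//.
by rewrite -(@ler_ofR R k) ofR_rnorm ofR1.
Qed.

Definition op_norm f : K := sup_norm [set x | `|x| <= 1] f.

Lemma op_norm_ub f x : `|f x| <= op_norm f * `|x|.
Proof.
have [->|x0] := eqVneq x 0; first by rewrite linear0 !normr0 mulr0.
have nx0 : 0 < `|x| by rewrite normr_gt0.
rewrite -ler_pdivrMr// mulrC -[X in X * _]ger0_norm ?invr_ge0//.
rewrite -normrZ -linearZ; apply: sup_norm_ub; first exact: blin_bounded.
by rewrite /= normrZ normfV normr_id mulVf// gt_eqF.
Qed.

Lemma op_normD f g : op_norm (f + g) <= op_norm f + op_norm g.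
Proof. by apply: sup_normD; exact: blin_bounded. Qed.

Lemma op_normZ (l : K) f : op_norm (l *: f) = `|l| * op_norm f.
Proof. by apply: sup_normZ; exact: blin_bounded. Qed.

Lemma op_norm_eq0 f : op_norm f = 0 -> f = 0.
Proof.
move=> f0; apply/val_inj/funext => x /=; apply/normr0_eq0/eqP.
by rewrite eq_le normr_ge0 andbT -(mul0r `|x|) -f0 op_norm_ub.
Qed.

HB.instance Definition _ :=
  Lmodule_isNormed.Build K blin op_normD op_normZ op_norm_eq0.

Lemma ler_blin f x : `|f x| <= `|f| * `|x|.
Proof. exact: op_norm_ub. Qed.

Lemma bounded_linearP (f : V -> W) (M : K) :
  linear f -> (forall x, `|f x| <= M * `|x|) -> f \in bounded_linear.
Proof.
move=> lf fM; apply/asboolP; split => //.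
exists (rnorm (M : K^o)) => x; rewrite -(@ler_ofR R k) ofRM !ofR_rnorm.
have [->|x0] := eqVneq x 0; first by have := fM 0; rewrite normr0 !mulr0.
apply: (le_trans (fM x)); rewrite ler_wpM2r//; apply: real_ler_norm.
apply: ger0_real; have := le_trans (normr_ge0 _) (fM x).
by rewrite pmulr_lge0// normr_gt0.
Qed.

End bounded_operators.

Notation dual V := (@blin _ _ V (scalars _ _)^o).

Section operations.
Context {R : realType} {k : scalar_kind}.
Local Notation K := (scalars R k).

Section evaluation.
Variables V W : normedModType K.

Fact eval_subproof (x : V) :
  (fun f : blin V W => f x) \in @bounded_linear R k (blin V W) W.
Proof.
apply: (@bounded_linearP _ _ _ _ _ `|x|) => [l f g //|f].
by rewrite mulrC ler_blin.
Qed.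

Definition eval_at (x : V) : blin (blin V W) W := Blin (eval_subproof x).

End evaluation.

Section composition.
Variables U V W : normedModType K.

Fact comp_subproof (g : blin V W) (f : blin U V) :
  (fun x => g (f x)) \in @bounded_linear R k U W.
Proof.
apply: (@bounded_linearP _ _ _ _ _ (`|g| * `|f|)) => [l x y|x].
  by rewrite !linearP.
by rewrite (le_trans (ler_blin _ _))// -mulrA ler_wpM2l// ler_blin.
Qed.

Definition blin_comp (g : blin V W) (f : blin U V) : blin U W :=
  Blin (comp_subproof g f).

End composition.

Fact bidual_subproof (Y : normedModType K) :
  (fun y : Y => eval_at K^o y) \in @bounded_linear R k Y (dual (dual Y)).
Proof.
apply: (@bounded_linearP _ _ _ _ _ 1) => [l x y|y].
  by apply/val_inj/funext => f /=; rewrite linearP.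
rewrite mul1r; apply: sup_norm_le => //= f f1.
by rewrite (le_trans (ler_blin _ _))// ler_piMl.
Qed.

Definition to_bidual (Y : normedModType K) : blin Y (dual (dual Y)) :=
  Blin (bidual_subproof Y).

Definition adjoint (U V : normedModType K) (A : blin U V) (y' : dual V) : dual U :=
  blin_comp y' A.

End operations.

Section continuous_functions.
Variables (R : realType) (k : scalar_kind).
Local Notation K := (scalars R k).
Context {T : topologicalType}.

Definition continuous_pred : {pred T -> K} := [pred f | `[< continuous f >]].

Record continuous_fun (cT : compact [set: T]) := CFun {
  cfun_val :> T -> K;
  _ : cfun_val \in continuous_pred }.

Variable cT : compact [set: T].
Local Notation C := (continuous_fun cT).

HB.instance Definition _ := [isSub for @cfun_val cT].
HB.instance Definition _ := [Choice of C by <:].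

Lemma continuous_submod : @submod_closed K (T -> K^o) continuous_pred.
Proof.
split; first by apply/asboolP => x; exact: cvg_cst.
move=> l f g /asboolP cf /asboolP cg; apply/asboolP => x.
by apply: cvgD; [apply: cvgZr; exact: cf|exact: cg].
Qed.
HB.instance Definition _ :=
  GRing.isSubmodClosed.Build K (T -> K^o) continuous_pred continuous_submod.
HB.instance Definition _ := [SubChoice_isSubLmodule of C by <:].

Implicit Types f g : C.

Lemma cfun_continuous f : continuous f.
Proof. by have /asboolP := valP f. Qed.

Lemma cfun_bounded f : norm_bounded_on [set: T] (f : T -> K^o).
Proof.
have rD (u v : K^o) : rnorm u - rnorm v <= rnorm (u - v).
  by rewrite lerBlDr -{1}(subrK v u) rnormD.
have cf : continuous (fun x => rnorm (f x : K^o)).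
  move=> x; apply/cvgrPdist_le => e e0.
  have e0K : 0 < ofR e :> K.
    by rewrite lt_def -(@ofR0 R k) ler_ofR (ltW e0) andbT (can_eq (@ofRK R k)) gt_eqF.
  have /cvgrPdist_le /(_ _ e0K) := @cfun_continuous f x.
  apply: filterS => y; rewrite -(@ofR_rnorm R k K^o) ler_ofR => fxy.
  rewrite ler_norml lerNl opprB; apply/andP; split; apply: le_trans (rD _ _) _ => //.
  by rewrite /rnorm distrC.
have /compact_bounded[M [_ fM]] := continuous_compact (continuous_subspaceT cf) cT.
exists (M + 1) => x _; apply: le_trans (ler_norm _) _.
by apply: (fM (M + 1)); [rewrite ltrDl|exists x].
Qed.

Definition cfun_norm f : K := sup_norm [set: T] (f : T -> K^o).

Lemma cfun_normD f g : cfun_norm (f + g) <= cfun_norm f + cfun_norm g.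
Proof. by apply: sup_normD; exact: cfun_bounded. Qed.

Lemma cfun_normZ (l : K) f : cfun_norm (l *: f) = `|l| * cfun_norm f.
Proof. by apply: sup_normZ; exact: cfun_bounded. Qed.

Lemma cfun_norm_eq0 f : cfun_norm f = 0 -> f = 0.
Proof.
move=> f0; apply/val_inj/funext => x /=.
by apply: (sup_norm_eq0 (cfun_bounded f) f0).
Qed.

HB.instance Definition _ :=
  Lmodule_isNormed.Build K C cfun_normD cfun_normZ cfun_norm_eq0.

End continuous_functions.

Section vector_measures.
Context {R : realType} {k : scalar_kind} {T : topologicalType}.
Local Notation K := (scalars R k).

Definition borel : set (set T) := <<s open >>.

(* A set function on the Borel sets is a function on all sets, of which only
   the values at Borel sets matter. *)
Section in_normed_space.
Context {Z : normedModType K}.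
Implicit Types m : set T -> Z.

Definition vector_measure m : Prop :=
  forall A B, borel A -> borel B -> A `&` B = set0 ->
    m (A `|` B) = m A + m B.

Definition semivariation m : \bar R :=
  ereal_sup [set s | exists (n : nat) (E : 'I_n -> set T) (eps : 'I_n -> K),
    [/\ forall i, borel (E i), trivIset [set: 'I_n] E, \bigcup_i E i = setT,
        forall i, `|eps i| <= 1 &
        s = (rnorm (\sum_(i < n) eps i *: m (E i)))%:E]].

Definition bounded_vector_measure m : Prop :=
  vector_measure m /\ (semivariation m < +oo)%E.

Definition borel_simple (f : T -> K) : Prop :=
  finite_set (range f) /\ forall a, borel (f @^-1` [set a]).

Definition simple_integral m (f : T -> K) : Z :=
  \sum_(a \in range f) a *: m (f @^-1` [set a]).

(* The limit of the integrals of simple functions that converge uniformly to f;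
   for a bounded vector measure it does not depend on the choice of s. *)
Definition vintegral m (f : T -> K) : Z :=
  xget 0 [set z | exists s : nat -> T -> K,
    [/\ forall n, borel_simple (s n), {uniform, s @ \oo --> f} &
        simple_integral m (s n) @[n --> \oo] --> z]].

End in_normed_space.

Definition countably_additive (mu : set T -> K^o) : Prop :=
  forall E : nat -> set T, (forall n, borel (E n)) -> trivIset [set: nat] E ->
    series (fun n => mu (E n)) @ \oo --> mu (\bigcup_n E n).

(* Regularity of an additive set function, stated without its variation, as in
   Dunford and Schwartz, III.5.11. *)
Definition regular (mu : set T -> K^o) : Prop :=
  forall E, borel E -> forall e : R, 0 < e ->
    exists F G : set T, [/\ closed F, open G, F `<=` E, E `<=` G &
      forall B, borel B -> B `<=` G `\` F -> rnorm (mu B) < e].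

(* The measure mu is an element of the dual of C(T), namely the functional F. *)
Definition measure_is_functional (cT : compact [set: T]) (mu : set T -> K^o)
    (F : dual (continuous_fun R k cT)) : Prop :=
  [/\ regular mu, countably_additive mu &
      forall phi : continuous_fun R k cT, F phi = vintegral mu phi].

End vector_measures.

Section weak_star.
Context {R : realType} {k : scalar_kind}.
Local Notation K := (scalars R k).

Definition weak_star (V : normedModType K) : topologicalType :=
  initial_topology (fun f : dual V => (f : V -> K^o) : {ptws V -> K^o}).

Definition weak_star_continuous (U V : normedModType K)
    (L : dual U -> dual V) : Prop :=
  continuous (L : weak_star U -> weak_star V).

End weak_star.

Section projective_tensor_product.
Context {R : realType} {k : scalar_kind}.
Local Notation K := (scalars R k).
Variables X V : normedModType K.

(* The formal sum [:: (x_1, v_1); ...; (x_n, v_n)] stands for the element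
   x_1 (x) v_1 + ... + x_n (x) v_n of the algebraic tensor product. *)
Definition formal_tensor := seq (X * V).

Definition tensor_apply {W : zmodType} (b : X -> V -> W) (u : formal_tensor) : W :=
  \sum_(p <- u) b p.1 p.2.

(* Two formal sums are the same tensor when all bilinear forms agree on them. *)
Definition same_tensor (u w : formal_tensor) : Prop :=
  forall b : X -> V -> K^o,
    (forall v, linear (b^~ v)) -> (forall x, linear (b x)) ->
    tensor_apply b u = tensor_apply b w.

Definition tensor_sub (u w : formal_tensor) : formal_tensor :=
  u ++ [seq (- p.1, p.2) | p <- w].

Definition projective_norm (u : formal_tensor) : R :=
  inf [set \sum_(p <- w) rnorm p.1 * rnorm p.2 | w in same_tensor u].

(* An element of the completion of the algebraic tensor product under the
   projective norm, given by a Cauchy sequence that represents it. *)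
Record projective_tensor := ProjectiveTensor {
  tensor_seq : nat -> formal_tensor;
  tensor_seq_cauchy : forall e : R, 0 < e -> exists N : nat, forall i j : nat,
    (N <= i)%N -> (N <= j)%N ->
    projective_norm (tensor_sub (tensor_seq i) (tensor_seq j)) < e }.

(* The duality between the completed tensor product and the operators from X
   to the dual of V; the limit depends only on the class of the sequence. *)
Definition tensor_pairing (u : projective_tensor) (A : blin X (dual V)) : K^o :=
  limn (fun n => tensor_apply (fun x v => A x v) (tensor_seq u n)).

End projective_tensor_product.

Section representing_measures.
Context {R : realType} {k : scalar_kind}.
Local Notation K := (scalars R k).
Context {T : topologicalType} (cT : compact [set: T]).
Local Notation C := (continuous_fun R k cT).

(* E |-> m(E)x, written m_x *)
Definition measure_at {X Z : normedModType K} (m : set T -> blin X Z) (x : X)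
  : set T -> Z := fun E => m E x.

(* E |-> <y', m(E)x>, written mu_{x,y'} *)
Definition scalar_measure {X Y : normedModType K}
    (m : set T -> blin X (dual (dual Y))) (x : X) (y' : dual Y) : set T -> K^o :=
  fun E => m E x y'.

(* phi |-> (S phi)x, written S_x *)
Definition operator_at {X Y : normedModType K} (S : blin C (blin X Y)) (x : X)
  : blin C Y := blin_comp (eval_at Y x) S.

(* Among all bounded vector measures with the same integrals of continuous
   functions, representing measures are weak*-regular: a merely finitely
   additive measure is not determined by these integrals. *)
Definition classical_representing_measure {Z : normedModType K}
    (A : blin C Z) (G : set T -> dual (dual Z)) : Prop :=
  [/\ bounded_vector_measure G,
      forall z' : dual Z, regular (fun E => G E z') &
      forall phi : C, to_bidual Z (A phi) = vintegral G phi].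

Definition representing_measure {X Y : normedModType K}
    (S : blin C (blin X Y)) (m : set T -> blin X (dual (dual Y))) : Prop :=
  [/\ bounded_vector_measure m,
      forall (x : X) (y' : dual Y), regular (scalar_measure m x y') &
      forall phi : C, blin_comp (to_bidual Y) (S phi) = vintegral m phi].

Definition weak_star_countably_additive {X V : normedModType K}
    (m : set T -> blin X (dual V)) : Prop :=
  forall (u : projective_tensor X V) (E : nat -> set T),
    (forall n, borel (E n)) -> trivIset [set: nat] E ->
    series (fun n => tensor_pairing u (m (E n))) @ \oo
      --> tensor_pairing u (m (\bigcup_n E n)).

End representing_measures.

(* Main.v *)
Require Import Defs.
From HB Require Import structures.
From mathcomp Require Import all_boot all_order all_algebra.
From mathcomp Require Import finmap complex ring lra.
From mathcomp Require Import all_classical all_reals all_analysis.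

Set Implicit Arguments.
Unset Strict Implicit.
Unset Printing Implicit Defensive.

Import Order.TTheory GRing.Theory Num.Theory.
Import numFieldNormedType.Exports.

Local Open Scope classical_set_scope.
Local Open Scope ring_scope.

(** Fix [S], [x : X] and [y' : dual Y].  The functional sending [f] to
[y' (S f x)] is bounded on the continuous functions, and by the Riesz theorem
it is integration against a unique regular scalar measure, of variation at most
[rnorm S * rnorm x * rnorm y'].  Uniqueness makes the value of this measure at
a Borel set [E] bilinear in [(x, y')], and the bound makes it a bounded
bilinear form; a bounded bilinear form on [X] and [dual Y] is an operator from
[X] to the bidual of [Y], and this operator is [m E].  Every claim on [m] is
then tested on pairs [(x, y')]: its integrals, its semivariation (at most
[rnorm S], [semivariation_bilinear_le]), and its uniqueness
([scalar_measure_riesz]).  The other half of the norm equality is the estimate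
of an integral by the semivariation, together with the fact that [Y] embeds
isometrically in its bidual ([rnorm_to_bidual]).

Conversely let [m] satisfy the weak* continuity condition.  For fixed [f] and
[x], the integral of [f] against the measure indexed by [(x, y')] is a
weak*-continuous functional of [y'], hence evaluation at a vector of [Y]
([weak_star_functional]); that vector is [S f x].

Weak* countable additivity: the integrals [m E x y'] are countably additive in
[E], so the claim holds for finite sums of elementary tensors, and the
operators [m E] form a bounded set, on which the pairing with an element of the
completed tensor product is a uniform limit of pairings with such sums
([tensor_pairing_approx]).

The Riesz theorem is proved for real and complex scalars at once, without
splitting the functional [Lam] into positive parts.  The [variation] of an open
set [U] is the supremum of [rnorm (Lam g)] over continuous [g] bounded by 1 and
vanishing off [U].  It generates an outer measure [outer_variation] for which
Borel sets are Caratheodory measurable, and which controls [Lam]: if [g] is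
bounded by [M] and vanishes off [U], then [rnorm (Lam g)] is at most [M] times
the measure of [U].  Given closed [F], open [G] and [F `<=` E `<=` G], two
Urysohn functions between [F] and [G] differ only on the gap [G `\` F]; since
gaps can be made arbitrarily small, the values of [Lam] at these functions
converge, and the limit is [riesz_measure E].  It is dominated by
[outer_variation E], from which regularity, countable additivity and the bound
on the semivariation all follow.  The same Urysohn functions give uniqueness:
their integrals against any regular bounded additive set function converge to
its value at [E] ([sandwich_integral]). *)

(** * Norms with real values, and completeness of operator spaces *)

Lemma invn_le (R : realType) (e : R) : 0 < e -> exists N, forall n, (N <= n)%N -> n.+1%:R^-1 <= e.
Proof.
move=> e0; have [N _ hN] := near_infty_natSinv_lt (PosNum e0).
by exists N => n /hN /ltW.
Qed.

Lemma ler_addmul_gt0 (R : realType) (x a c : R) : 0 <= c ->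
  (forall e : R, 0 < e -> x <= a + e * c) -> x <= a.
Proof.
move=> c0 h; apply/ler_addgt0Pr => e e0.
have c1 : 0 < c + 1 by rewrite ltr_wpDl.
apply: le_trans (h _ (divr_gt0 e0 c1)) _; rewrite lerD2l mulrAC ler_pdivrMr//.
by rewrite ler_wpM2l ?(ltW e0)// lerDl.
Qed.

Section real_norms.
Context {R : realType} {k : scalar_kind}.
Local Notation K := (scalars R k).

Lemma ofR_gt0 (r : R) : (0 < ofR r :> K) = (0 < r).
Proof. by rewrite !lt_def -(@ofR0 R k) ler_ofR (can_eq (@ofRK R k)). Qed.

Lemma ofRN (r : R) : ofR (- r) = - ofR r :> K.
Proof. by apply/eqP; rewrite -addr_eq0 -ofRD addNr ofR0. Qed.

Lemma ofRB (r s : R) : ofR (r - s) = ofR r - ofR s :> K.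
Proof. by rewrite ofRD ofRN. Qed.

Lemma rnorm_ofR (r : R) : rnorm (ofR r : K^o) = `|r|.
Proof.
wlog r0 : r / 0 <= r.
  move=> h; have [/h//|/ltW r0] := leP 0 r.
  by rewrite -[r]opprK ofRN /rnorm normrN normrN; apply: h; rewrite oppr_ge0.
apply: (can_inj (@ofRK R k)); rewrite ofR_rnorm !ger0_norm//.
by rewrite -(@ofR0 R k) ler_ofR.
Qed.

Lemma rnormM (a b : K^o) : rnorm (a * b : K^o) = rnorm a * rnorm b.
Proof. exact: (rnormZ a (b : K^o)). Qed.

Lemma ler_rnorm (V : normedModType K) (v : V) (r : R) :
  (`|v| <= ofR r) = (rnorm v <= r).
Proof. by rewrite -ofR_rnorm ler_ofR. Qed.

Section vectors.
Variable V : normedModType K.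
Implicit Types u v w : V.

Lemma rnormN v : rnorm (- v) = rnorm v.
Proof. by rewrite /rnorm normrN. Qed.

Lemma rnormB u v : rnorm (u - v) <= rnorm u + rnorm v.
Proof. by rewrite (le_trans (rnormD _ _))// rnormN. Qed.

Lemma rnorm_distC u v : rnorm (u - v) = rnorm (v - u).
Proof. by rewrite -rnormN opprB. Qed.

Lemma rnorm_triangle v u w : rnorm (u - w) <= rnorm (u - v) + rnorm (v - w).
Proof. by have := rnormD (u - v) (v - w); rewrite addrA subrK. Qed.

Lemma rnorm_le_dist u v : rnorm u <= rnorm v + rnorm (u - v).
Proof. by rewrite -{1}(subrK v u) addrC rnormD. Qed.

Lemma rnorm_sum (I : Type) (r : seq I) (P : pred I) (F : I -> V) :
  rnorm (\sum_(i <- r | P i) F i) <= \sum_(i <- r | P i) rnorm (F i).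
Proof.
elim/big_ind2 : _ => [|x1 x2 y1 y2 h1 h2|//]; first by rewrite rnorm0.
by rewrite (le_trans (rnormD _ _))// lerD.
Qed.

Lemma rnorm_eq0_small v (c : R) :
  0 <= c -> (forall e : R, 0 < e -> rnorm v <= c * e) -> v = 0.
Proof.
move=> c0 h; apply/rnorm0_eq0/eqP; rewrite eq_le rnorm_ge0 andbT.
apply/ler_addgt0Pl => e e0; rewrite addr0.
have c1 : 0 < c + 1 by rewrite ltr_wpDl.
apply: (le_trans (h (e / (c + 1)) _)); first by rewrite divr_gt0.
by rewrite mulrA ler_pdivrMr// mulrC ler_wpM2l ?(ltW e0)// lerDl.
Qed.

Lemma cvg_rnormP (I : Type) (F : set_system I) (FF : Filter F) (u : I -> V) l :
  u @ F --> l <->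
  forall e : R, 0 < e -> \forall x \near F, rnorm (l - u x) <= e.
Proof.
split=> [/cvgrPdist_le ul e e0|ul].
  have /ul : 0 < ofR e :> K by rewrite ofR_gt0.
  by apply: filterS => x; rewrite ler_rnorm.
apply/cvgrPdist_le => e e0; have er := toRK (ltW e0).
have /ul : 0 < toR e by rewrite -(ofR_gt0) er.
by apply: filterS => x; rewrite -ler_rnorm er.
Qed.

Lemma cvgn_rnormP (u : nat -> V) l : u @ \oo --> l <->
  forall e : R, 0 < e -> exists N, forall n, (N <= n)%N -> rnorm (l - u n) <= e.
Proof.
split=> [/cvg_rnormP ul e /ul[N _ h]|h]; first by exists N => n /h.
by apply/cvg_rnormP => e /h[N hN]; exists N.
Qed.

Lemma rnorm_lim (u : nat -> V) (l w : V) (M : R) :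
  u @ \oo --> l -> (\forall n \near \oo, rnorm (w - u n) <= M) -> rnorm (w - l) <= M.
Proof.
move=> /cvg_rnormP ul hM; apply/ler_addgt0Pr => e /ul h.
near \oo => n; apply: le_trans (rnorm_triangle (u n) _ _) _.
by rewrite lerD//; [near: n|rewrite rnorm_distC; near: n].
Unshelve. all: by end_near. Qed.

End vectors.

(** Replaces, for both scalar fields, multiplication by the conjugate of a phase. *)
Lemma unimodular_rotation (z : K) : exists c : K,
  rnorm (c : K^o) = 1 /\ c * z = ofR (rnorm (z : K^o)).
Proof.
have [->|z0] := eqVneq z 0.
  exists 1; rewrite mulr0 rnorm0 ofR0; split=> //.
  by rewrite -(@ofR1 R k) rnorm_ofR normr1.
exists (`|z| / z); split; last by rewrite divfK// ofR_rnorm.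
apply: (can_inj (@ofRK R k)); rewrite ofR_rnorm ofR1.
by rewrite normrM normfV normr_id divff// normr_eq0.
Qed.

Lemma continuous_rnorm (V : normedModType K) : continuous (@rnorm R k V).
Proof.
move=> v; apply/cvgrPdist_le => e e0.
have /cvg_rnormP/(_ _ e0) : id @ v --> v by exact: cvg_id.
apply: filterS => u h; rewrite ler_norml lerNl opprB; apply/andP; split.
  by rewrite lerBlDl (le_trans (rnorm_le_dist u v))// lerD2l rnorm_distC.
by rewrite lerBlDl (le_trans (rnorm_le_dist v u))// lerD2l.
Qed.

Lemma continuous_ofR : continuous (ofR : R -> K^o).
Proof.
move=> r; apply/(@cvg_rnormP K^o) => e e0.
have /cvgrPdist_le/(_ _ e0) : id @ r --> r by exact: cvg_id.
by apply: filterS => s; rewrite -ofRB rnorm_ofR.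
Qed.

End real_norms.

Lemma cvgn_unique (R : realType) (k : scalar_kind) (V : normedModType (scalars R k))
  (u : nat -> V) (l l' : V) : u @ \oo --> l -> u @ \oo --> l' -> l = l'.
Proof. by move=> ul; apply: cvg_unique ul; exact: norm_hausdorff. Qed.

Section banach.
Context {R : realType} {k : scalar_kind}.
Local Notation K := (scalars R k).

Definition cauchy_sequence (V : normedModType K) (u : nat -> V) :=
  forall e : R, 0 < e -> exists N, forall i j, (N <= i)%N -> (N <= j)%N ->
    rnorm (u i - u j) <= e.

Definition banach (V : normedModType K) :=
  forall u : nat -> V, cauchy_sequence u -> exists l : V, u @ \oo --> l.

End banach.

Lemma real_cauchy_cvg (R : realType) (u : nat -> R) :
  (forall e : R, 0 < e -> exists N, forall i j, (N <= i)%N -> (N <= j)%N ->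
    `|u i - u j| <= e) -> exists l : R, u @ \oo --> l.
Proof.
move=> cu; suff: cvg (u @ \oo) by move=> /cvg_ex.
apply: R_complete; apply/cauchy_ballP => e e0.
have [N hN] := cu (e / 2) (divr_gt0 e0 (ltr0Sn _ 1)).
exists ([set u n | n in [set n | (N <= n)%N]], [set u n | n in [set n | (N <= n)%N]]).
  by split; exists N => // n /= Nn; exists n.
move=> [_ _] [[i Ni <-] [j Nj <-]] /=; rewrite /ball /=.
by apply: le_lt_trans (hN i j Ni Nj) _; rewrite ltr_pdivrMr// ltr_pMr// ltr1n.
Qed.

Lemma normc_le (R : realType) (a b : R) :
  complex.Re (`|(a +i* b)%C|) <= `|a| + `|b|.
Proof.
rewrite -[leRHS]ger0_norm ?addr_ge0// -sqrtr_sqr ler_sqrt ?sqr_ge0//.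
by rewrite sqrrD !real_normK ?num_real// lerD2r lerDl mulrn_wge0// mulr_ge0.
Qed.

Lemma normc_ge_ReIm (R : realType) (a b : R) :
  `|a| <= complex.Re (`|(a +i* b)%C|) /\ `|b| <= complex.Re (`|(a +i* b)%C|).
Proof.
by split; rewrite -sqrtr_sqr ler_sqrt ?addr_ge0 ?sqr_ge0// ?lerDl ?lerDr sqr_ge0.
Qed.

Section banach_spaces.
Context {R : realType} {k : scalar_kind}.
Local Notation K := (scalars R k).

(** In the complex case, through the coordinates. *)
Lemma banach_scalars : banach (K^o).
Proof.
move=> u; case: k u => u cu /=.
  by have [l ul] := real_cauchy_cvg cu; exists l.
have [|a ha] := @real_cauchy_cvg R (fun n => complex.Re (u n)).
  move=> e /cu[N hN]; exists N => i j Ni Nj; apply: le_trans (hN i j Ni Nj).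
  rewrite /rnorm /=; case: (u i) (u j) => [a b] [c d] /=.
  exact: (normc_ge_ReIm (a - c) (b - d)).1.
have [|b hb] := @real_cauchy_cvg R (fun n => complex.Im (u n)).
  move=> e /cu[N hN]; exists N => i j Ni Nj; apply: le_trans (hN i j Ni Nj).
  rewrite /rnorm /=; case: (u i) (u j) => [a' b] [c d] /=.
  exact: (normc_ge_ReIm (a' - c) (b - d)).2.
exists (a +i* b)%C; apply/(@cvg_rnormP R ComplexScalars) => e e0.
have e20 : 0 < e / 2 by rewrite divr_gt0.
move/cvgrPdist_le : ha => /(_ _ e20) ha; move/cvgrPdist_le : hb => /(_ _ e20) hb.
near=> n; have h1 : `|a - complex.Re (u n)| <= e / 2 by near: n.
have h2 : `|b - complex.Im (u n)| <= e / 2 by near: n.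
rewrite /rnorm /=; case: (u n) h1 h2 => [c d] /= h1 h2.
apply: le_trans (normc_le (a - c) (b - d)) _.
by rewrite [e]splitr lerD.
Unshelve. all: by end_near. Qed.

Section blin.
Variables V W : normedModType K.
Implicit Types f g : blin V W.

Lemma rnorm_blin_le f x : rnorm (f x) <= rnorm f * rnorm x.
Proof. by rewrite -ler_rnorm ofRM !ofR_rnorm ler_blin. Qed.

Lemma rnorm_blin_lub f (M : R) :
  0 <= M -> (forall x, rnorm (f x) <= M * rnorm x) -> rnorm f <= M.
Proof.
move=> M0 h; rewrite -ler_rnorm; apply: sup_norm_le.
  by rewrite -(@ofR0 R k) ler_ofR.
move=> x /=; rewrite -(@ofR1 R k) ler_rnorm => x1; rewrite ler_rnorm.
by rewrite (le_trans (h x))// -[leRHS]mulr1 ler_wpM2l.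
Qed.

Lemma blinE f g : (forall x, f x = g x) -> f = g.
Proof. by move=> fg; apply/val_inj/funext. Qed.

Lemma blinP (f : V -> W) (M : R) : linear f ->
  (forall x, rnorm (f x) <= M * rnorm x) -> f \in @bounded_linear R k V W.
Proof. by move=> lf fM; apply/asboolP; split=> //; exists M. Qed.

Lemma blinD f g x : (f + g) x = f x + g x. Proof. by []. Qed.
Lemma blinB f g x : (f - g) x = f x - g x. Proof. by []. Qed.
Lemma blinZ (a : K) f x : (a *: f) x = a *: f x. Proof. by []. Qed.

Lemma blin_sum (I : Type) (r : seq I) (P : pred I) (F : I -> blin V W) x :
  (\sum_(i <- r | P i) F i) x = \sum_(i <- r | P i) F i x.
Proof. by elim/big_ind2 : _ => // f y g z <- <-. Qed.

(** The pointwise limit of a Cauchy sequence of operators is also its limit in norm,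
    because the Cauchy estimate passes to the limit pointwise. *)
Lemma banach_blin : banach W -> banach (blin V W).
Proof.
move=> bW u cu.
have cux x : cauchy_sequence (fun n => u n x).
  move=> e e0; have x1 : 0 < rnorm x + 1 by rewrite ltr_wpDl ?rnorm_ge0.
  have [N hN] := cu (e / (rnorm x + 1)) (divr_gt0 e0 x1).
  exists N => i j Ni Nj; rewrite -blinB (le_trans (rnorm_blin_le _ _))//.
  apply: (@le_trans _ _ (rnorm (u i - u j) * (rnorm x + 1))).
    by rewrite ler_wpM2l ?rnorm_ge0// lerDl.
  by rewrite -ler_pdivlMr// hN.
have /choice[l hl] : forall x : V, exists l : W, (fun n => u n x) @ \oo --> l
  by move=> x; have [l ?] := bW _ (cux x); exists l.
have ll : linear l.
  move=> a x y; apply: (@cvg_unique _ (@norm_hausdorff _ W) (u n (a *: x + y) @[n --> \oo])).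
    exact: hl.
  have -> : (fun n => u n (a *: x + y)) = (fun n => a *: u n x + u n y).
    by apply/funext => n; rewrite linearP.
  by apply: cvgD (hl y); apply: cvgZr; exact: hl.
have [N1 hN1] := cu 1 ltr01.
have ulip (e : R) N : (forall i j, (N <= i)%N -> (N <= j)%N -> rnorm (u i - u j) <= e) ->
    forall n x, (N <= n)%N -> rnorm (u n x - l x) <= e * rnorm x.
  move=> h n x Nn; apply: (rnorm_lim (hl x)); exists N => // i /= Ni.
  rewrite -blinB (le_trans (rnorm_blin_le _ _))// ler_wpM2r ?rnorm_ge0//.
  exact: h.
have lb x : rnorm (l x) <= (rnorm (u N1) + 1) * rnorm x.
  apply: le_trans (rnorm_le_dist _ (u N1 x)) _; rewrite mulrDl lerD ?rnorm_blin_le//.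
  by rewrite rnorm_distC; apply: (ulip 1 N1).
exists (Blin (blinP ll lb)); apply/cvgn_rnormP => e e0.
have [N hN] := cu e e0; exists N => n Nn; apply: rnorm_blin_lub; first exact: ltW.
by move=> x; rewrite blinB rnorm_distC; exact: (ulip e N).
Qed.

End blin.

End banach_spaces.

(** * Norming functionals (Hahn-Banach over both scalar fields) *)

Section hahn_banach.
Context {R : realType} {k : scalar_kind}.
Local Notation K := (scalars R k).

Lemma toR_le_rnorm (z : K) : toR z <= rnorm (z : K^o).
Proof.
rewrite /rnorm; case: k z => /= [z|[a b]]; first exact: ler_norm.
exact: le_trans (ler_norm _) (normc_ge_ReIm a b).1.
Qed.

(** Over the complex numbers the functional is $f(v) - i f(iv)$, the only complex
    linear one whose real part is $f$. *)
Lemma real_part_complexification (V : normedModType K) (f : V -> R) :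
  (forall t u v, f (ofR t *: u + v) = t * f u + f v) ->
  exists F : V -> K^o, linear F /\ forall v, toR (F v) = f v.
Proof.
case: k V f => /= V f fl; first by exists f.
have f0 : f 0 = 0 by have := fl (-1) 0 0; rewrite scaler0 addr0 mulN1r addNr.
have fD u v : f (u + v) = f u + f v by have := fl 1 u v; rewrite scale1r mul1r.
have fZ t u : f (t%:C%C *: u) = t * f u.
  by have := fl t u 0; rewrite f0 !addr0.
exists (fun v => (f v +i* - f ('i%C *: v))%C); split=> // -[a b] u v.
have -> : (a +i* b)%C = (a%:C + b%:C * 'i)%C :> R[i].
  by apply/eqP; rewrite eq_complex /= !(mul0r, mulr0, mulr1, subr0, addr0, add0r) !eqxx.
have iuE : 'i%C *: ((a%:C + b%:C * 'i)%C *: u + v) =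
    a%:C%C *: ('i%C *: u) + (- b)%:C%C *: u + 'i%C *: v.
  rewrite scalerDr !scalerA -scalerDl; congr (_ *: _ + _).
  by apply/eqP; rewrite eq_complex /= !(mul0r, mulr0, mulr1, mul1r, subr0, sub0r, addr0, add0r, oppr0) !eqxx.
rewrite iuE scalerDl -scalerA !fD !fZ.
apply/eqP; rewrite eq_complex /=.
rewrite !(mul0r, mulr0, mulr1, mul1r, subr0, addr0, add0r, oppr0).
apply/andP; split; apply/eqP; ring.
Qed.

Section real_functional.
Variables (V : normedModType K) (v0 : V).

Definition real_linear_graph (G : set (V * R)) := forall (t : R) p q, G p -> G q ->
  G (ofR t *: p.1 + q.1, t * p.2 + q.2).

(** Partial real-linear functionals are handled as their graphs, as sets of pairs:
    domination by the norm forces such a set to be single-valued, so inclusion of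
    sets is extension of functionals and a union of a chain needs no gluing.  The
    last clause is conditional so that the empty graph, which is the union of the
    empty chain, qualifies. *)
Definition norming_graph (G : set (V * R)) :=
  [/\ real_linear_graph G, forall p, G p -> p.2 <= rnorm p.1 &
      G !=set0 -> G (v0, rnorm v0)].

Lemma norming_graph_bigcup (F : set (set (V * R))) :
  F `<=` norming_graph -> total_on F subset -> norming_graph (\bigcup_(G in F) G).
Proof.
move=> FP tF; split=> [t p q [G FG Gp] [H FH Hq]|p [G FG Gp]|[p [G FG Gp]]].
- have [GH|HG] := tF _ _ FG FH.
  + by exists H => //; have [lH _ _] := FP _ FH; apply: lH => //; exact: GH.
  + by exists G => //; have [lG _ _] := FP _ FG; apply: lG => //; exact: HG.
- by have [_ + _] := FP _ FG; apply.
- by exists G => //; have [_ _] := FP _ FG; apply; exists p.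
Qed.

Lemma norming_graph_line :
  norming_graph [set p | exists t, p = (ofR t *: v0, t * rnorm v0)].
Proof.
split=> [t p q [a ->] [b ->]|p [t ->]|_] /=.
- by exists (t * a + b); rewrite ofRD ofRM scalerDl scalerA mulrDl mulrA.
- by rewrite rnormZ rnorm_ofR ler_wpM2r ?rnorm_ge0// ler_norm.
- by exists 1; rewrite ofR1 scale1r mul1r.
Qed.

(** The extension step: the admissible values at $v$ lie between the supremum of
    $f(u) - |u - v|$ and the infimum of $|u + v| - f(u)$, an interval which is
    nonempty by the triangle inequality. *)
Lemma norming_graph_extend (A : set (V * R)) (v : V) :
  norming_graph A -> A (0, 0) -> exists B, [/\ norming_graph B, A `<=` B &
    exists c, B (v, c)].
Proof.
move=> [lA bA nA] A0.
have AZ t p : A p -> A (ofR t *: p.1, t * p.2).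
  by move=> Ap; have := lA t _ _ Ap A0; rewrite /= !addr0.
pose S := [set p.2 - rnorm (p.1 - v) | p in A].
have Sub p : A p -> ubound S (rnorm (p.1 + v) - p.2).
  move=> Ap _ [q Aq <-]; rewrite lerBlDr addrAC lerBrDr.
  have := bA _ (lA 1 _ _ Aq Ap); rewrite /= ofR1 scale1r mul1r => /le_trans; apply.
  have -> : q.1 + p.1 = (p.1 + v) + (q.1 - v) by rewrite addrACA subrr addr0 addrC.
  exact: rnormD.
pose c := sup S.
have cge p : A p -> p.2 - rnorm (p.1 - v) <= c.
  by move=> Ap; apply: ub_le_sup; [exists (rnorm (0 + v) - 0); exact: (Sub _ A0)|exists p].
have cle p : A p -> c <= rnorm (p.1 + v) - p.2.
  by move=> Ap; apply: ge_sup; [exists (0 - rnorm (0 - v)), (0, 0)|exact: Sub].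
exists [set q | exists p t, A p /\ q = (p.1 + ofR t *: v, p.2 + t * c)]; split.
- split=> [t _ _ [p [a [Ap ->]]] [q [b [Aq ->]]]|_ [p [t [Ap ->]]]|[_ [p [t [Ap _]]]]].
  + exists (ofR t *: p.1 + q.1, t * p.2 + q.2), (t * a + b); split; first exact: lA.
    congr pair => /=; last by rewrite mulrDr mulrDl addrACA mulrA.
    by rewrite ofRD ofRM scalerDr scalerDl scalerA addrACA.
  (* For t > 0 divide by t and use the upper bound on c; for t < 0, the lower one. *)
  + have [t0|t0|->] := ltgtP t 0 => /=; last first.
    * by rewrite ofR0 scale0r mul0r !addr0; exact: bA.
    * have := cle _ (AZ t^-1 _ Ap); rewrite /= lerBrDl => h.
      have := ler_wpM2l (ltW t0) h; rewrite mulrDr mulrA mulfV ?gt_eqF// mul1r.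
      move=> /le_trans; apply.
      rewrite -[X in X * _ <= _](@ger0_norm _ t) ?(ltW t0)// -(@rnorm_ofR R k) -rnormZ.
      by rewrite scalerDr scalerA -ofRM mulfV ?gt_eqF// ofR1 scale1r.
    * have := cge _ (AZ (- t)^-1 _ Ap); rewrite /= lerBlDr => h.
      have t0' : 0 < - t by rewrite oppr_gt0.
      have := ler_wpM2l (ltW t0') h; rewrite mulrDr mulrA mulfV ?gt_eqF// mul1r.
      rewrite mulNr -lerBlDl opprK => /le_trans; apply.
      rewrite -[X in X * _ <= _](@ger0_norm _ (- t)) ?(ltW t0')// -(@rnorm_ofR R k) -rnormZ.
      rewrite scalerBr scalerA -ofRM mulfV ?gt_eqF// ofR1 scale1r.
      by rewrite ofRN scaleNr opprK.
  + by exists (v0, rnorm v0), 0; split; [apply: nA; exists p|rewrite ofR0 scale0r mul0r !addr0].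
- by move=> [p1 p2] Ap; exists (p1, p2), 0; split=> //; rewrite ofR0 scale0r mul0r !addr0.
- by exists c, (0, 0), 1; split=> //; rewrite ofR1 scale1r mul1r !add0r.
Qed.

Lemma norming_real_functional : exists f : V -> R,
  [/\ forall t u v, f (ofR t *: u + v) = t * f u + f v,
      forall v, f v <= rnorm v & f v0 = rnorm v0].
Proof.
(* A maximal graph is nonempty, since the line through v0 carries one, and total. *)
have [A [PA maxA]] := Zorn_bigcup norming_graph_bigcup.
have [lA bA nA] := PA.
have A0 : A !=set0.
  apply/set0P/eqP => A0; apply: (maxA _ _ norming_graph_line); split.
    by rewrite A0; exact: sub0set.
  by rewrite A0 => /(_ (v0, rnorm v0)); apply; exists 1; rewrite ofR1 scale1r mul1r.
have Av0 := nA A0.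
have A00 : A (0, 0).
  by have := lA (-1) _ _ Av0 Av0; rewrite /= ofRN ofR1 scaleN1r mulN1r !addNr.
have tot v : exists r, A (v, r).
  have [B [PB AB [c Bc]]] := norming_graph_extend v PA A00.
  exists c; apply: contrapT => nAc; apply: (maxA _ _ PB).
  by split=> // /(_ _ Bc).
have uniq v r s : A (v, r) -> A (v, s) -> r = s.
  have le r' s' : A (v, r') -> A (v, s') -> r' <= s'.
    move=> Ar As; have := bA _ (lA (-1) _ _ As Ar).
    by rewrite /= ofRN ofR1 scaleN1r addNr rnorm0 mulN1r addrC subr_le0.
  by move=> Ar As; apply/eqP; rewrite eq_le !le.
have [f fA] := choice tot.
exists f; split=> [t u v|v|]; last exact: (uniq _ _ _ (fA v0) Av0).
  exact: (uniq _ _ _ (fA _) (lA t _ _ (fA u) (fA v))).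
exact: (bA _ (fA v)).
Qed.

End real_functional.

(** The complexification of a real functional dominated by the norm has norm at most
    one: rotate $v$ until the value at $v$ is real. *)
Theorem norming_functional (V : normedModType K) (v : V) :
  exists F : dual V, rnorm F <= 1 /\ rnorm v <= rnorm (F v).
Proof.
have [f [fl fb fv]] := norming_real_functional v.
have [F [Fl FE]] := real_part_complexification fl.
have Fb u : rnorm (F u) <= 1 * rnorm u.
  have [c [c1 cE]] := unimodular_rotation (F u).
  have : c *: F u = F (c *: u) by have := Fl c u 0; rewrite (_ : F 0 = 0) ?addr0//;
    have := Fl (-1) 0 0; rewrite scaler0 addr0 scaleN1r addNr.
  rewrite /= => cF; rewrite -[leLHS](@ofRK R k) -cE [c * _]cF FE.
  by rewrite (le_trans (fb _))// rnormZ c1.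
exists (Blin (blinP Fl Fb)); split; first exact: rnorm_blin_lub.
by rewrite -fv -FE toR_le_rnorm.
Qed.

Lemma rnorm_to_bidual (V : normedModType K) (v : V) : rnorm (to_bidual V v) = rnorm v.
Proof.
apply/eqP; rewrite eq_le; apply/andP; split.
  apply: rnorm_blin_lub; first exact: rnorm_ge0.
  by move=> f; rewrite mulrC; exact: (rnorm_blin_le f v).
have [F [F1 Fv]] := norming_functional v; apply: (le_trans Fv).
apply: le_trans (rnorm_blin_le (to_bidual V v) F) _.
by rewrite ler_piMr// rnorm_ge0.
Qed.

Lemma to_bidual_inj (V : normedModType K) (u v : V) :
  (forall f : dual V, f u = f v) -> u = v.
Proof.
move=> h; apply/eqP; rewrite -subr_eq0; apply/eqP/rnorm0_eq0.
rewrite -rnorm_to_bidual (_ : to_bidual V (u - v) = 0) ?rnorm0//.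
apply: blinE => f; rewrite /= (_ : f (u - v) = f u - f v); last exact: linearB.
by rewrite h subrr.
Qed.

End hahn_banach.

(** * Integration of continuous functions against vector measures *)

Section borel_sets.
Context {T : topologicalType}.
Implicit Types A B : set T.

Lemma borel0 : borel (@set0 T). Proof. exact: sigma_algebra0. Qed.

Lemma borelC A : borel A -> borel (~` A).
Proof. by move=> bA; rewrite -setTD; exact: (@sigma_algebraCD _ setT open A bA). Qed.

Lemma borelT : borel [set: T].
Proof. by rewrite -setC0; apply: borelC; exact: borel0. Qed.

Lemma borel_bigcup (F : nat -> set T) : (forall n, borel (F n)) -> borel (\bigcup_n F n).
Proof. exact: (@sigma_algebra_bigcup _ setT open F). Qed.

Lemma borelU A B : borel A -> borel B -> borel (A `|` B).
Proof.
by move=> bA bB; rewrite -bigcup2E; apply: borel_bigcup => -[|[|n]]//=; exact: borel0.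
Qed.

Lemma borelI A B : borel A -> borel B -> borel (A `&` B).
Proof. by move=> /borelC ? /borelC ?; rewrite -[_ `&` _]setCK setCI; apply: borelC; apply: borelU. Qed.

Lemma borelD A B : borel A -> borel B -> borel (A `\` B).
Proof. by move=> bA /borelC bB; rewrite setDE; exact: borelI. Qed.

Lemma borel_open A : open A -> borel A.
Proof. exact: sub_sigma_algebra. Qed.

Lemma borel_closed A : closed A -> borel A.
Proof. by move=> cA; rewrite -[A]setCK; apply: borelC; apply: borel_open; exact: closed_openC. Qed.

Lemma mem_set_cons (I : eqType) (i : I) (r : seq I) :
  [set` i :: r] = [set i] `|` [set` r].
Proof.
apply/seteqP; split=> j /=; first by rewrite inE => /orP[/eqP|]; [left|right].
by case=> [->|jr]; rewrite inE ?eqxx// jr orbT.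
Qed.

Lemma borel_bigcup_seq (I : eqType) (r : seq I) (E : I -> set T) :
  (forall i, borel (E i)) -> borel (\bigcup_(i in [set` r]) E i).
Proof.
move=> bE; elim: r => [|i r IH]; first by rewrite set_nil bigcup_set0; exact: borel0.
by rewrite mem_set_cons bigcup_setU1; apply: borelU.
Qed.

End borel_sets.

Lemma finite_union_pred (I : finType) (U : Type) (P : pred I) (E : I -> set U) :
  \bigcup_(i in [set` P]) E i = \bigcup_(i in [set` enum P]) E i.
Proof.
by apply: eq_bigcupl; split=> i /=; rewrite mem_enum.
Qed.

(** Phrased for an arbitrary, possibly empty, topological space, and obtained from
    the filter of the finite index sequences that contain a given one. *)
Lemma compact_finite_cover (T : topologicalType) (A : set T) (I : eqType)
    (f : I -> set T) : compact A -> (forall i, open (f i)) ->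
  A `<=` \bigcup_i f i -> exists r : seq I, A `<=` \bigcup_(i in [set` r]) f i.
Proof.
move=> /compact_near_coveringP cA fo Af.
pose F := filter_from [set: seq I] (fun r => [set s : seq I | {subset r <= s}]).
have FF : Filter F.
  apply: filter_from_filter; first by exists [::].
  move=> r s _ _; exists (r ++ s) => // t /= rst.
  by split=> i ir; apply: rst; rewrite mem_cat ir ?orbT.
have [x /Af[i _ fxi]|r _ hr] := cA _ F (fun r => \bigcup_(i in [set` r]) f i) FF; last first.
  by exists r; exact: hr.
exists (f i, [set s : seq I | {subset [:: i] <= s}]).
  by split=> /=; [exact: open_nbhs_nbhs|exists [:: i]].
by move=> [y s] [/= fiy si]; exists i => //=; apply: si; rewrite inE.
Qed.

Section finitely_additive.
Context {R : realType} {k : scalar_kind} {T : topologicalType}.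
Local Notation K := (scalars R k).
Variable Z : normedModType K.
Variable m : set T -> Z.
Hypothesis am : vector_measure m.

Lemma vector_measure0 : m set0 = 0.
Proof.
have := am borel0 borel0 (setI0 _); rewrite setU0 => /eqP.
by rewrite -subr_eq subrr eq_sym => /eqP.
Qed.

Lemma vector_measureD A B : borel A -> borel B -> B `<=` A -> m (A `\` B) = m A - m B.
Proof.
move=> bA bB BA; rewrite -{2}(setDUK BA) am//; last by rewrite setDIK.
  by rewrite addrC addKr.
exact: borelD.
Qed.

Lemma vector_measure_seq (I : eqType) (r : seq I) (E : I -> set T) : uniq r ->
  (forall i, borel (E i)) -> trivIset setT E ->
  m (\bigcup_(i in [set` r]) E i) = \sum_(i <- r) m (E i).
Proof.
move=> + bE tE; elim: r => [_|i r IH /= /andP[ir ur]].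
  by rewrite set_nil bigcup_set0 big_nil vector_measure0.
rewrite mem_set_cons bigcup_setU1 big_cons -IH// am//; first exact: borel_bigcup_seq.
rewrite -subset0 => x [Eix [j /= jr Ejx]].
have ij := tE i j Logic.I Logic.I (ex_intro _ x (conj Eix Ejx)).
by rewrite ij jr in ir.
Qed.

Lemma vector_measure_pred (I : finType) (P : pred I) (E : I -> set T) :
  (forall i, borel (E i)) -> trivIset setT E ->
  m (\bigcup_(i in [set` P]) E i) = \sum_(i | P i) m (E i).
Proof.
move=> bE tE; rewrite finite_union_pred vector_measure_seq ?enum_uniq//.
by rewrite big_enum.
Qed.

End finitely_additive.

Section partitions.
Context {R : realType} {k : scalar_kind} {T : topologicalType}.
Local Notation K := (scalars R k).

Definition borel_partition (I : finType) (E : I -> set T) :=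
  [/\ forall i, borel (E i), trivIset setT E & forall x, exists i, E i x].

(** Some of the sets may be empty and some of the values may coincide: unlike the
    decomposition by values, this form is stable under common refinement. *)
Definition step_function (I : finType) (E : I -> set T) (c : I -> K) (f : T -> K) :=
  forall i x, E i x -> f x = c i.

Lemma borel_partition_step (I : finType) (E : I -> set T) (c : I -> K) :
  borel_partition E -> exists f, step_function E c f.
Proof.
move=> [_ tE cE]; have [g Eg] := choice cE; exists (c \o g) => i x Eix /=.
by congr c; apply: (tE _ _ Logic.I Logic.I); exists x.
Qed.

Lemma step_preimage (I : finType) (E : I -> set T) (c : I -> K) (f : T -> K) a :
  borel_partition E -> step_function E c f ->
  f @^-1` [set a] = \bigcup_(i in [set` [pred i | c i == a]]) E i.
Proof.
move=> [_ _ cE] fE; apply/seteqP; split=> x /=.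
  by have [i Eix] := cE x; rewrite (fE _ _ Eix) => ?; exists i => //=; exact/eqP.
by move=> [i /eqP <-]; exact: fE.
Qed.

Lemma step_borel_simple (I : finType) (E : I -> set T) (c : I -> K) (f : T -> K) :
  borel_partition E -> step_function E c f -> borel_simple f.
Proof.
move=> pE fE; have [bE _ cE] := pE; split.
  apply: (@sub_finite_set _ _ (c @` [set: I])).
    by move=> _ [x _ <-]; have [i /fE ->] := cE x; exists i.
  by apply: finite_image; exact: finite_finset.
by move=> a; rewrite (step_preimage a pE fE) finite_union_pred; exact: borel_bigcup_seq.
Qed.

Lemma borel_simple_step (f : T -> K) : borel_simple f ->
  exists (I : finType) (E : I -> set T) (c : I -> K),
    borel_partition E /\ step_function E c f.
Proof.
move=> [finf bf]; exists (fset_sub_type (fset_set (range f))), (fun a => f @^-1` [set val a]), val.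
split=> //; split=> [a|a b _ _ [x [/= fa fb]]|x]; [exact: bf|by apply: val_inj => /=; rewrite -fa -fb|].
have fx : f x \in fset_set (range f) by rewrite in_fset_set// inE; exists x.
by exists [` fx]%fset.
Qed.

Lemma borel_partition_prod (I J : finType) (E : I -> set T) (F : J -> set T) :
  borel_partition E -> borel_partition F ->
  borel_partition (fun p : I * J => E p.1 `&` F p.2).
Proof.
move=> [bE tE cE] [bF tF cF]; split=> [p|[i j] [i' j'] _ _ [x [[/= a b] [/= c d]]]|x].
- exact: borelI.
- by congr pair; [apply: (tE _ _ Logic.I Logic.I)|apply: (tF _ _ Logic.I Logic.I)]; exists x.
- by have [i Ei] := cE x; have [j Fj] := cF x; exists (i, j).
Qed.

Section integrals.
Variables (Z : normedModType K) (m : set T -> Z).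
Hypothesis am : vector_measure m.

(** Grouping the indices by the value of $c$ gives the preimages of points; indices
    of empty sets may carry values outside the range of $f$ but contribute nothing. *)
Lemma simple_integral_step (I : finType) (E : I -> set T) (c : I -> K) (f : T -> K) :
  borel_partition E -> step_function E c f ->
  simple_integral m f = \sum_i c i *: m (E i).
Proof.
move=> pE fE; have [bE tE cE] := pE; have [finf _] := step_borel_simple pE fE.
rewrite /simple_integral fsbig_finite//=.
have fa a : a *: m (f @^-1` [set a]) = \sum_(i | c i == a) c i *: m (E i).
  rewrite (step_preimage a pE fE) vector_measure_pred// scaler_sumr.
  by apply: eq_bigr => i /eqP ->.
rewrite (eq_bigr _ (fun a _ => fa a)).
rewrite (exchange_big_dep xpredT)//=; apply: eq_bigr => i _.
have [->|/set0P[x Eix]] := eqVneq (E i) set0.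
  by rewrite vector_measure0// scaler0 big1.
under eq_bigl do rewrite eq_sym.
rewrite -big_filter filter_pred1_uniq ?fset_uniq// ?big_seq1//.
by rewrite in_fset_set// inE; exists x => //; exact: fE.
Qed.

Lemma simple_integral_sub_step (I J : finType) (E : I -> set T) (F : J -> set T) c d f g :
  borel_partition E -> step_function E c f ->
  borel_partition F -> step_function F d g ->
  simple_integral m f - simple_integral m g =
    \sum_(p : I * J) (c p.1 - d p.2) *: m (E p.1 `&` F p.2).
Proof.
move=> pE fE pF gF; have pEF := borel_partition_prod pE pF.
rewrite (@simple_integral_step _ _ (c \o fst) _ pEF); last by move=> p x [/fE].
rewrite (@simple_integral_step _ _ (d \o snd) _ pEF); last by move=> p x [_ /gF].
by rewrite -sumrB; apply: eq_bigr => p _; rewrite scalerBl.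
Qed.

Lemma semivariation_ge0 : (0 <= semivariation m)%E.
Proof.
apply: ereal_sup_ubound; exists 1%N, (fun=> setT), (fun=> 0); split.
- by move=> _; exact: borelT.
- by move=> i j _ _ _; rewrite !ord1.
- by apply/seteqP; split=> // x _; exists ord0.
- by move=> _; rewrite normr0.
- by rewrite big1 ?rnorm0// => i _; rewrite scale0r.
Qed.

(** The semivariation bounds sums with coefficients in the unit ball; here the
    coefficients are in the ball of radius $d$, except those on empty sets. *)
Lemma partition_sum_le (I : finType) (E : I -> set T) (c : I -> K) (M d : R) :
  (semivariation m <= M%:E)%E -> borel_partition E -> 0 < d ->
  (forall i x, E i x -> rnorm (c i : K^o) <= d) ->
  rnorm (\sum_i c i *: m (E i)) <= d * M.
Proof.
move=> mM [bE tE cE] d0 cd.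
have [c' c'E c'd] : exists2 c' : I -> K, (forall i, c i *: m (E i) = c' i *: m (E i)) &
    forall i, rnorm (c' i : K^o) <= d.
  exists (fun i => if E i == set0 then 0 else c i) => i.
    by case: eqVneq => // ->; rewrite vector_measure0// !scaler0.
  by case: eqVneq => [_|/set0P[x]]; [rewrite rnorm0 ltW|exact: cd].
under eq_bigr do rewrite c'E.
have -> : \sum_i c' i *: m (E i) = ofR d *: \sum_i (ofR d^-1 * c' i) *: m (E i).
  rewrite scaler_sumr; apply: eq_bigr => i _.
  by rewrite scalerA mulrA -ofRM mulfV ?gt_eqF// ofR1 mul1r.
rewrite rnormZ rnorm_ofR gtr0_norm// ler_pM2l// -lee_fin; apply: le_trans mM.
apply: ereal_sup_ubound.
exists #|I|, (E \o enum_val), (fun j => ofR d^-1 * c' (enum_val j)); split.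
- by move=> i; exact: bE.
- by move=> i j _ _ h; apply/enum_val_inj/(tE _ _ Logic.I Logic.I).
- by apply/seteqP; split=> // x _; have [i Ei] := cE x; exists (enum_rank i) => //=; rewrite enum_rankK.
- move=> i; rewrite -(@ofR1 R k) (@ler_rnorm R k K^o) rnormM rnorm_ofR.
  by rewrite ger0_norm ?invr_ge0 ?(ltW d0)// mulrC ler_pdivrMr// mul1r.
- by congr (rnorm _)%:E; rewrite (reindex_onto enum_val enum_rank)/=;
    [apply: eq_bigl => j; rewrite enum_valK eqxx|move=> i _; exact: enum_rankK].
Qed.

Lemma measure_le (M : R) A : (semivariation m <= M%:E)%E -> borel A -> rnorm (m A) <= M.
Proof.
move=> mM bA.
have pA : borel_partition (fun b : bool => if b then A else ~` A).
  split=> [[]//|[] [] _ _ [x []]//|x]; first exact: borelC.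
  by have [?|?] := pselect (A x); [exists true|exists false].
have := @partition_sum_le _ _ (fun b : bool => if b then 1 else 0) _ 1 mM pA ltr01.
rewrite big_bool /= scale1r scale0r addr0 mul1r; apply=> -[] x _.
  by rewrite -(@ofR1 R k) rnorm_ofR normr1.
by rewrite rnorm0.
Qed.

Lemma simple_integral_dist f g (M d : R) : (semivariation m <= M%:E)%E -> 0 < d ->
  borel_simple f -> borel_simple g ->
  (forall x, rnorm (f x - g x : K^o) <= d) ->
  rnorm (simple_integral m f - simple_integral m g) <= d * M.
Proof.
move=> mM d0 /borel_simple_step[I [E [c [pE fE]]]] /borel_simple_step[J [F [e [pF gF]]]] fg.
rewrite (simple_integral_sub_step pE fE pF gF).
apply: (@partition_sum_le _ _ (fun p => c p.1 - e p.2)) => //.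
  exact: borel_partition_prod.
by move=> [i j] x [/= Ei Fj]; rewrite -(fE _ _ Ei) -(gF _ _ Fj).
Qed.

End integrals.

Lemma uniform_cvg_rnormP (s : nat -> T -> K) (f : T -> K) :
  {uniform, s @ \oo --> f} <->
  forall e : R, 0 < e -> exists N, forall n, (N <= n)%N ->
    forall x, rnorm (f x - s n x : K^o) <= e.
Proof.
split=> [sf e e0|h P /uniform_nbhs[E [entE EP]]].
  have e0K : 0 < ofR e :> K by rewrite ofR_gt0.
  have : nbhs (f : {uniform T -> K}) [set h | forall x, rnorm (f x - h x : K^o) <= e].
    apply/uniform_nbhs; exists [set xy : K * K | ball xy.1 (PosNum e0K)%:num xy.2].
    split=> [|h Eh x]; first exact: entourage_ball.
    by have := Eh x Logic.I; rewrite /= /ball /= => /ltW; rewrite (@ler_rnorm R k K^o).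
  by move=> /sf[N _ hN]; exists N => n /hN.
move: entE; rewrite -entourage_ballE => -[e /= e0 eE].
have er := toRK (ltW e0).
have er0 : 0 < toR e / 2 by rewrite divr_gt0// -(@ofR_gt0 R k) er.
have [N hN] := h _ er0; exists N => // n /hN fn; apply: EP => x _; apply: eE.
rewrite /= /ball /=; apply: (@le_lt_trans _ _ (ofR (toR e / 2))).
  by rewrite (@ler_rnorm R k K^o).
by rewrite -[ltRHS]er -subr_gt0 -ofRB ofR_gt0 subr_gt0 ltr_pdivrMr// ltr_pMr ?ltr1n// -(@ofR_gt0 R k) er.
Qed.

Definition approximable (f : T -> K) := forall d : R, 0 < d ->
  exists s, borel_simple s /\ forall x, rnorm (f x - s x : K^o) <= d.

Lemma approximable_seq f : approximable f ->
  exists2 s : nat -> T -> K, forall n, borel_simple (s n) &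
    forall n x, rnorm (f x - s n x : K^o) <= n.+1%:R^-1.
Proof.
move=> af; have /choice[s hs] n := af n.+1%:R^-1 ltac:(by rewrite invr_gt0).
by exists s => n; have [] := hs n.
Qed.

Section vintegral.
Variables (Z : normedModType K) (m : set T -> Z) (M : R).
Hypotheses (am : vector_measure m) (mM : (semivariation m <= M%:E)%E).

Lemma semivariation_bound_ge0 : 0 <= M.
Proof. by rewrite -lee_fin (le_trans (semivariation_ge0 m)). Qed.

(** The estimate that characterises the integral of a uniform limit of simple
    functions among all vectors, without reference to a particular sequence. *)
Definition integral_value (f : T -> K) (z : Z) := forall (d : R) s, 0 < d ->
  borel_simple s -> (forall x, rnorm (f x - s x : K^o) <= d) ->
  rnorm (z - simple_integral m s) <= d * M.

Lemma vintegral_limit f z : approximable f -> integral_value f z ->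
  [set z | exists s : nat -> T -> K,
    [/\ forall n, borel_simple (s n), {uniform, s @ \oo --> f} &
        simple_integral m (s n) @[n --> \oo] --> z]] z.
Proof.
move=> af fz; have [s ss sf] := approximable_seq af.
exists s; split=> //.
  apply/uniform_cvg_rnormP => e /invn_le[N hN]; exists N => n /hN h x.
  exact: le_trans (sf n x) h.
apply/cvgn_rnormP => e e0.
have M1 : 0 < M + 1 by rewrite ltr_wpDl// semivariation_bound_ge0.
have [N hN] := invn_le (divr_gt0 e0 M1); exists N => n /hN h.
apply: le_trans (fz n.+1%:R^-1 _ _ (ss n) (sf n)) _; first by rewrite invr_gt0.
rewrite ler_pdivlMr// in h; apply: le_trans h.
by rewrite ler_wpM2l ?invr_ge0// lerDl.
Qed.

Lemma vintegral_eq f z : approximable f -> integral_value f z -> vintegral m f = z.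
Proof.
move=> af fz; rewrite /vintegral; case: xgetP => [z' _ [s [ss sf sz']]|/(_ z)]; last first.
  by have := vintegral_limit af fz.
apply: (@cvg_unique _ (@norm_hausdorff _ Z) _ _ _ _ sz').
apply/cvgn_rnormP => e e0.
have M1 : 0 < M + 1 by rewrite ltr_wpDl// semivariation_bound_ge0.
have eM := divr_gt0 e0 M1.
have [N hN] := (uniform_cvg_rnormP _ _).1 sf _ eM; exists N => n /hN h.
apply: le_trans (fz _ _ eM (ss n) h) _.
by rewrite -[leRHS](divfK (lt0r_neq0 M1)) ler_wpM2l ?(ltW eM)// lerDl.
Qed.

(** Completeness is what makes the integrals of approximating simple functions
    converge, so that [vintegral] is a true limit and not its default value. *)
Lemma vintegral_value f : banach Z -> approximable f -> integral_value f (vintegral m f).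
Proof.
move=> bZ af; suff [z fz] : exists z, integral_value f z by rewrite (vintegral_eq af fz).
have [s ss sf] := approximable_seq af.
have M1 : 0 < M + 1 by rewrite ltr_wpDl// semivariation_bound_ge0.
have dist i d t : 0 < d -> borel_simple t -> (forall x, rnorm (f x - t x : K^o) <= d) ->
    rnorm (simple_integral m (s i) - simple_integral m t) <= (i.+1%:R^-1 + d) * M.
  move=> d0 st ft; apply: simple_integral_dist => //; first by rewrite addr_gt0 ?invr_gt0.
  move=> x; apply: le_trans (rnorm_triangle (f x : K^o) _ _) _.
  by rewrite lerD// rnorm_distC.
have [|z hz] := bZ (fun n => simple_integral m (s n)).
  move=> e e0; have [N hN] := invn_le (divr_gt0 (divr_gt0 e0 M1) (ltr0Sn _ 1)).
  exists N => i j /hN hi /hN hj.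
  apply: le_trans (dist i _ _ _ (ss j) (sf j)) _; first by rewrite invr_gt0.
  apply: (@le_trans _ _ (e / (M + 1) * (M + 1))); last by rewrite divfK// gt_eqF.
  apply: ler_pM; rewrite ?semivariation_bound_ge0 ?lerDl ?addr_ge0 ?invr_ge0//.
  by rewrite [leRHS]splitr lerD.
exists z => d t d0 st ft; apply/ler_addgt0Pr => e e0.
move/cvgn_rnormP : hz => /(_ (e / 2)) [|N1 hN1]; first by rewrite divr_gt0.
have [N2 hN2] := invn_le (divr_gt0 (divr_gt0 e0 M1) (ltr0Sn _ 1)).
(* At this index the n-th term is close to the limit z and s n is close to f. *)
pose n := maxn N1 N2.
apply: le_trans (rnorm_triangle (simple_integral m (s n)) _ _) _.
have h1 := hN1 n (leq_maxl _ _); have h2 := hN2 n (leq_maxr _ _).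
apply: le_trans (lerD h1 (dist n d t d0 st ft)) _.
have h3 : n.+1%:R^-1 * M <= e / 2.
  apply: (@le_trans _ _ (e / (M + 1) / 2 * (M + 1))).
    by apply: ler_pM; rewrite ?invr_ge0 ?semivariation_bound_ge0 ?lerDl.
  by rewrite mulrAC divfK// gt_eqF.
by rewrite mulrDl addrA [leRHS]addrC lerD2r [leRHS]splitr lerD2l.
Qed.

End vintegral.

(** Compactness: finitely many sets on which $f$ varies by less than $d$ cover the
    space; making them disjoint gives a partition. *)
Lemma approximable_continuous (f : T -> K) :
  compact [set: T] -> continuous f -> approximable f.
Proof.
move=> cT cf d d0.
have op x : open [set y | rnorm (f x - f y : K^o) < d].
  have cr : continuous (fun y => rnorm (f x - f y : K^o)).
    move=> y; apply: (@continuous_comp _ _ _ (fun y => f x - f y : K^o) (@rnorm R k K^o)).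
      by apply: cvgB; [exact: cvg_cst|exact: cf].
    exact: continuous_rnorm.
  exact: (open_comp (fun y _ => cr y) (@open_lt _ d)).
have [|r cD] := compact_finite_cover cT op.
  by move=> x _; exists x => //=; rewrite subrr rnorm0.
pose D := seq_sub r.
pose E (x : D) := [set y | rnorm (f (val x) - f y : K^o) < d].
(* Disjointification along an enumeration of the finite cover. *)
pose F (i : D) := E i `\` \bigcup_(j in [set` [pred j : D | (enum_rank j < enum_rank i)%N]]) E j.
have bE i : borel (E i) by apply: borel_open; exact: op.
have pF : borel_partition F.
  split=> [i|i j _ _ [y [[Ei nEi] [Ej nEj]]]|y].
  - by apply: borelD => //; rewrite finite_union_pred; exact: borel_bigcup_seq.
  - have ij : (enum_rank i <= enum_rank j)%N.
      by rewrite leqNgt; apply/negP => h; apply: nEi; exists j.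
    have ji : (enum_rank j <= enum_rank i)%N.
      by rewrite leqNgt; apply/negP => h; apply: nEj; exists i.
    by apply: enum_rank_inj; apply: ord_inj; apply: anti_leq; rewrite ij ji.
  - have [x0 /= x0D hx0] := cD y Logic.I; pose y0 : D := SeqSub x0D.
    have ex : exists n, [exists i : D, (val (enum_rank i) == n) && `[< E i y >]].
      exists (val (enum_rank y0)); apply/existsP; exists y0.
      by rewrite eqxx; exact/asboolP.
    case: (ex_minnP ex) => n /existsP[i /andP[/eqP ni /asboolP Eiy]] nmin.
    exists i; split=> // -[j /= ji Ejy].
    have /nmin : [exists i : D, (val (enum_rank i) == val (enum_rank j)) && `[< E i y >]].
      by apply/existsP; exists j; rewrite eqxx; exact/asboolP.
    by rewrite -ni leqNgt; apply/negP/negPn; exact: ji.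
have [s sF] := borel_partition_step (fun i : D => f (val i)) pF.
exists s; split; first exact: step_borel_simple sF.
move=> y; have [_ _ /(_ y)[i Fi]] := pF; rewrite (sF i y Fi).
by case: Fi => /ltW; rewrite rnorm_distC.
Qed.

End partitions.

(** * The variation of a functional on open sets, and its outer measure *)

Section continuous_functions.
Context {R : realType} {k : scalar_kind} {T : topologicalType}.
Local Notation K := (scalars R k).
Variable cT : compact [set: T].
Local Notation C := (continuous_fun R k cT).
Implicit Types f g : C.

Lemma cfunE f g : (forall x, f x = g x) -> f = g.
Proof. by move=> fg; apply/val_inj/funext. Qed.

Lemma exists_cfun (f : T -> K) : continuous f -> exists g : C, forall x, g x = f x.
Proof.
move=> cf; have fc : f \in @continuous_pred R k T by apply/asboolP.
by exists (CFun cT fc).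
Qed.

Lemma cfunD f g x : (f + g) x = f x + g x. Proof. by []. Qed.
Lemma cfunB f g x : (f - g) x = f x - g x. Proof. by []. Qed.
Lemma cfunZ (a : K) f x : (a *: f) x = a * f x. Proof. by []. Qed.

Lemma cfun_sum (I : Type) (r : seq I) (P : pred I) (F : I -> C) x :
  (\sum_(i <- r | P i) F i) x = \sum_(i <- r | P i) F i x.
Proof. by elim/big_ind2 : _ => // f y g z <- <-. Qed.

Lemma rnorm_cfun_ub f x : rnorm (f x : K^o) <= rnorm f.
Proof.
rewrite -ler_rnorm ofR_rnorm.
exact: (@sup_norm_ub R k T K^o setT f x (cfun_bounded f) Logic.I).
Qed.

Lemma rnorm_cfun_lub f (M : R) : 0 <= M -> (forall x, rnorm (f x : K^o) <= M) ->
  rnorm f <= M.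
Proof.
move=> M0 fM; rewrite -ler_rnorm; apply: (@sup_norm_le R k T K^o setT f).
  by rewrite -(@ofR0 R k) ler_ofR.
by move=> x _; rewrite ler_rnorm.
Qed.

Lemma continuous_real_rnorm f : continuous (fun x => rnorm (f x : K^o)).
Proof.
move=> x; apply: (@continuous_comp _ _ _ (f : T -> K^o) (@rnorm R k K^o)).
  exact: cfun_continuous.
exact: continuous_rnorm.
Qed.

Lemma continuous_ofR_comp (h : T -> R) : continuous h -> continuous (fun x => ofR (h x) : K).
Proof.
move=> ch x; apply: (@continuous_comp _ _ _ h (ofR : R -> K^o)); first exact: ch.
exact: continuous_ofR.
Qed.

Lemma exists_cfun_mul (h : T -> R) f : continuous h ->
  exists g : C, forall x, g x = ofR (h x) * f x.
Proof.
move=> ch; apply: exists_cfun => x.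
by apply: cvgM; [exact: (continuous_ofR_comp ch)|exact: cfun_continuous].
Qed.

(** The retraction onto the ball of radius $d$, $f \mapsto f d / \max(d, |f|)$.  It is
    used in place of cutting $f$ off: what remains, $f - g$, vanishes where $f$ is small. *)
Lemma radial_truncation f (d : R) : 0 < d -> exists g : C, forall x,
  [/\ rnorm (g x : K^o) <= d, rnorm (f x : K^o) <= d -> g x = f x &
      rnorm (f x - g x : K^o) <= rnorm (f x : K^o)].
Proof.
move=> d0; pose n x := rnorm (f x : K^o).
have md x : 0 < Num.max d (n x) by rewrite lt_max d0.
have [|g gE] := @exists_cfun_mul (fun x => d / Num.max d (n x)) f.
  move=> x; apply: cvgM; first exact: cvg_cst.
  apply: cvgV; first exact: lt0r_neq0.
  by apply: (@continuous_max _ _ (cst d) n x); [exact: cvg_cst|exact: continuous_real_rnorm].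
exists g => x; rewrite !gE; split.
- rewrite rnormM rnorm_ofR ger0_norm ?divr_ge0 ?(ltW d0) ?(ltW (md x))//.
  by rewrite mulrAC ler_pdivrMr// ler_pM2l// le_max lexx orbT.
- by move=> nd; rewrite max_l// divff ?gt_eqF// ofR1 mul1r.
- rewrite -{1}[f x]mul1r -(@ofR1 R k) -mulrBl -ofRB rnormM rnorm_ofR.
  have a1 : d / Num.max d (n x) <= 1 by rewrite ler_pdivrMr// mul1r le_max lexx.
  have a0 : 0 <= d / Num.max d (n x) by rewrite divr_ge0 ?(ltW d0) ?(ltW (md x)).
  by rewrite ler_piMl ?rnorm_ge0// ger0_norm ?subr_ge0// gerBl.
Qed.

(** The real function $h$ is kept because order and continuity are needed for it, while
    $f$ takes its values in the scalar field. *)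
Definition separates (F G : set T) (f : C) := exists h : T -> R,
  [/\ continuous h, forall x, f x = ofR (h x), forall x, 0 <= h x <= 1,
      forall x, F x -> h x = 1 & forall x, ~ G x -> h x = 0].

Lemma urysohn_cfun (F G : set T) : hausdorff_space T ->
  closed F -> open G -> F `<=` G -> exists f : C, separates F G f.
Proof.
move=> hT cF oG FG.
have /(@normal_separatorP R) nT : normal_space T by exact: compact_normal.
have /(@uniform_separatorP _ R)[h [ch h01 h0 h1]] : uniform_separator (~` G) F.
  apply: nT => //; first exact: open_closedC.
  by rewrite -subset0 => x [nG /FG].
have [f fE] := exists_cfun (continuous_ofR_comp ch).
exists f, h; split=> // x.
- by have /= := h01 _ (imageT h x); rewrite in_itv.
- by move=> Fx; apply: h1; exists x.
- by move=> nG; apply: h0; exists x.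
Qed.

End continuous_functions.

Section variation_of_open_sets.
Context {R : realType} {k : scalar_kind} {T : topologicalType}.
Local Notation K := (scalars R k).
Variable cT : compact [set: T].
Hypothesis hT : hausdorff_space T.
Local Notation C := (continuous_fun R k cT).
Variable Lam : dual C.
Implicit Types (U V : set T) (f g : C).

Definition test_function U g :=
  (forall x, rnorm (g x : K^o) <= 1) /\ (forall x, ~ U x -> g x = 0).

(** The total variation, on open sets, of the measure to be constructed. *)
Definition variation U : R := sup [set rnorm (Lam g) | g in test_function U].

Lemma test_function_le U g : test_function U g -> rnorm (Lam g) <= rnorm Lam.
Proof.
move=> [g1 _]; apply: le_trans (rnorm_blin_le Lam g) _.
by rewrite ler_piMr ?rnorm_ge0// rnorm_cfun_lub.
Qed.

Lemma test_function0 U : test_function U 0.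
Proof. by split=> // x; rewrite rnorm0. Qed.

Lemma has_sup_variation U : has_sup [set rnorm (Lam g) | g in test_function U].
Proof.
split; first by exists (rnorm (Lam 0)), 0 => //; exact: test_function0.
by exists (rnorm Lam) => _ [g /test_function_le gU <-].
Qed.

Lemma variation_ub U g : test_function U g -> rnorm (Lam g) <= variation U.
Proof. by move=> gU; apply: sup_upper_bound; [exact: has_sup_variation|exists g]. Qed.

Lemma variation_lub U (M : R) :
  (forall g, test_function U g -> rnorm (Lam g) <= M) -> variation U <= M.
Proof.
move=> gM; apply: ge_sup; first by have [] := has_sup_variation U.
by move=> _ [g /gM ? <-].
Qed.

Lemma variation_ge0 U : 0 <= variation U.
Proof. exact: le_trans (rnorm_ge0 _) (variation_ub (test_function0 U)). Qed.

Lemma variation_le U : variation U <= rnorm Lam.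
Proof. by apply: variation_lub => g; exact: test_function_le. Qed.

Lemma variation0 : variation set0 = 0.
Proof.
apply/eqP; rewrite eq_le variation_ge0 andbT; apply: variation_lub => g [_ g0].
by rewrite (_ : g = 0) ?linear0 ?rnorm0//; apply: cfunE => x; exact: g0.
Qed.

Lemma variationS U V : U `<=` V -> variation U <= variation V.
Proof.
move=> UV; apply: variation_lub => g [g1 g0]; apply: variation_ub.
by split=> // x nV; apply: g0 => /UV.
Qed.

Lemma variation_scale U g (M : R) : 0 < M ->
  (forall x, rnorm (g x : K^o) <= M) -> (forall x, ~ U x -> g x = 0) ->
  rnorm (Lam g) <= M * variation U.
Proof.
move=> M0 gM g0; have -> : g = ofR M *: (ofR M^-1 *: g).
  by rewrite scalerA -ofRM mulfV ?gt_eqF// ofR1 scale1r.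
rewrite linearZ rnormZ rnorm_ofR gtr0_norm// ler_pM2l//; apply: variation_ub.
split=> x; last by move=> /g0 gx0; rewrite cfunZ gx0 mulr0.
by rewrite cfunZ rnormM rnorm_ofR gtr0_norm ?invr_gt0// mulrC ler_pdivrMr// mul1r.
Qed.

(** Rotating a nearly optimal test function makes the value of the functional real and
    nonnegative, so that values at several test functions add up without cancellation. *)
Lemma variation_adherent U (e : R) : 0 < e ->
  exists g r, [/\ test_function U g, variation U - e <= r & Lam g = ofR r].
Proof.
move=> e0; have [_ [g gU <-] ge] := sup_adherent e0 (has_sup_variation U).
have [c [c1 cE]] := unimodular_rotation (Lam g).
exists (c *: g), (rnorm (Lam g)); split; last by rewrite linearZ.
  have [g1 g0] := gU; split=> x; first by rewrite cfunZ rnormM c1 mul1r.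
  by move=> /g0 gx0; rewrite cfunZ gx0 mulr0.
exact: ltW.
Qed.

(** Removing the radial truncation at level $e$ leaves a function that vanishes off the
    closed set where $g$ has modulus at least $e$, which lies inside $U$. *)
Lemma test_function_shrink U g (e : R) : 0 < e -> test_function U g ->
  exists g' F, [/\ closed F, F `<=` U, test_function F g' &
    rnorm (Lam (g - g')) <= e * rnorm Lam].
Proof.
move=> e0 [g1 g0]; have [t tE] := radial_truncation g e0.
exists (g - t), [set x | e <= rnorm (g x : K^o)]; split.
- exact: (preimage_closed (fun x _ => @continuous_real_rnorm _ _ _ _ g x) (@closed_ge _ e)).
- move=> x /= egx; apply: contrapT => /g0 gx0.
  by move: egx; rewrite gx0 rnorm0 leNgt e0.
- split=> x; rewrite cfunB; first by have [_ _ h] := tE x; exact: le_trans h (g1 x).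
  by move=> /negP; rewrite -ltNge => /ltW h; have [_ -> //] := tE x; rewrite subrr.
- rewrite opprB addrC subrK (le_trans (rnorm_blin_le _ _))// mulrC ler_wpM2r ?rnorm_ge0//.
  by apply: rnorm_cfun_lub; [exact: ltW|move=> x; have [] := tE x].
Qed.

(** Off $V$, a shrunk test function lives on a closed subset of $U$; a Urysohn function
    that is 1 there and 0 off $U$ splits it into a part for $U$ and a part for $V$. *)
Lemma variationU U V : open U -> open V ->
  variation (U `|` V) <= variation U + variation V.
Proof.
move=> oU oV; apply: variation_lub => g gUV.
apply: (@ler_addmul_gt0 _ _ _ (rnorm Lam)); first exact: rnorm_ge0.
move=> e e0; have [g' [F [cF FUV [g'1 g'0] gg']]] := test_function_shrink e0 gUV.
have [|||u [h [ch _ h01 h1 h0]]] := @urysohn_cfun R k T cT (F `&` ~` V) U hT.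
- by apply: closedI => //; exact: open_closedC.
- exact: oU.
- by move=> x [/FUV[]].
have [g1 g1E] := exists_cfun_mul g' ch.
have -> : g = g1 + (g' - g1) + (g - g') by rewrite [g1 + _]addrC subrK addrC subrK.
have hx x : 0 <= h x /\ h x <= 1 by have /andP[] := h01 x.
rewrite linearD linearD; apply: le_trans (rnormD _ _) _.
apply: lerD gg'; apply: le_trans (rnormD _ _) _.
apply: lerD; apply: variation_ub; split=> x.
- rewrite g1E rnormM rnorm_ofR ger0_norm ?(hx x).1//.
  by rewrite mulr_ile1 ?rnorm_ge0 ?(hx x).1 ?(hx x).2.
- by move=> /h0 hx0; rewrite g1E hx0 ofR0 mul0r.
- rewrite cfunB g1E -{1}[g' x]mul1r -(@ofR1 R k) -mulrBl -ofRB rnormM rnorm_ofR.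
  have h1x : 0 <= 1 - h x by rewrite subr_ge0 (hx x).2.
  by rewrite ger0_norm// mulr_ile1 ?rnorm_ge0// gerBl (hx x).1.
- move=> nV; rewrite cfunB g1E; have [Fx|/g'0 ->] := pselect (F x).
    by rewrite h1// ofR1 mul1r subrr.
  by rewrite mulr0 subrr.
Qed.

Lemma variation_bigU (I : eqType) (r : seq I) (U : I -> set T) : (forall n, open (U n)) ->
  variation (\bigcup_(i in [set` r]) U i) <= \sum_(i <- r) variation (U i).
Proof.
move=> oU; elim: r => [|i r IH].
  by rewrite set_nil bigcup_set0 big_nil variation0.
rewrite mem_set_cons bigcup_setU1 big_cons.
apply: le_trans (variationU _ _) _ => //; last by rewrite lerD2l.
exact: bigcup_open.
Qed.

(** A shrunk test function lives on a compact set, which finitely many of the open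
    sets cover. *)
Lemma variation_bigcup (U : nat -> set T) : (forall n, open (U n)) ->
  ((variation (\bigcup_n U n))%:E <= \sum_(i <oo) (variation (U i))%:E)%E.
Proof.
move=> oU; apply/lee_addgt0Pr => e e0.
have N1 : 0 < rnorm Lam + 1 by rewrite ltr_wpDl ?rnorm_ge0.
have [g [r [gU ger gE]]] := variation_adherent (\bigcup_n U n) (divr_gt0 e0 (ltr0Sn _ 1)).
(* Chosen so that shrinking costs at most e / 2. *)
pose e' := e / 2 / (rnorm Lam + 1).
have e'0 : 0 < e' by rewrite !divr_gt0.
have [g' [F [cF FU [g'1 g'0] gg']]] := test_function_shrink e'0 gU.
have [s Fs] := compact_finite_cover (subclosed_compact cF cT (@subsetT _ _)) oU FU.
pose n := (\max_(i <- s) i).+1.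
have sn : test_function (\bigcup_(i in [set` iota 0 n]) U i) g'.
  split=> // x nU; apply: g'0 => /Fs[i /= si Ui]; apply: nU; exists i => //.
  by have : i \in iota 0 n by rewrite mem_iota add0n ltnS; exact: leq_bigmax_seq.
have h : variation (\bigcup_n U n) <= \sum_(i <- iota 0 n) variation (U i) + e.
  have : r <= rnorm (Lam g') + e / 2.
    apply: (@le_trans _ _ (rnorm (Lam g))); first by rewrite gE rnorm_ofR ler_norm.
    apply: le_trans (rnorm_le_dist _ (Lam g')) _; rewrite lerD2l -linearB.
    apply: le_trans gg' _; rewrite /e' mulrAC ler_pdivrMr//.
    by rewrite ler_wpM2l ?lerDl// divr_ge0 ?(ltW e0).
  have := le_trans (variation_ub sn) (variation_bigU (iota 0 n) oU).
  move: ger; lra.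
apply: (@le_trans _ _ (\sum_(i <- iota 0 n) variation (U i) + e)%:E).
  by rewrite lee_fin.
rewrite EFinD leeD2r// -sumEFin.
have := @nneseries_lim_ge R (fun i => (variation (U i))%:E) xpredT 0 n.
rewrite /index_iota subn0; apply => i _ _.
by rewrite lee_fin variation_ge0.
Qed.

Definition outer_variation (A : set T) : R :=
  inf [set variation U | U in [set U | open U /\ A `<=` U]].

Lemma has_inf_outer_variation A : has_inf [set variation U | U in [set U | open U /\ A `<=` U]].
Proof.
split; first by exists (variation setT), setT => //; split=> //; exact: openT.
by exists 0 => _ [U _ <-]; exact: variation_ge0.
Qed.

Lemma outer_variation_le A U : open U -> A `<=` U -> outer_variation A <= variation U.
Proof.
move=> oU AU; apply: ge_inf; first by have [] := has_inf_outer_variation A.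
by exists U.
Qed.

Lemma outer_variation_glb A (M : R) :
  (forall U, open U -> A `<=` U -> M <= variation U) -> M <= outer_variation A.
Proof.
move=> h; apply: lb_le_inf; first by have [] := has_inf_outer_variation A.
by move=> _ [U [oU AU] <-]; exact: h.
Qed.

Lemma outer_variation_open U : open U -> outer_variation U = variation U.
Proof.
move=> oU; apply/eqP; rewrite eq_le outer_variation_le//=.
by apply: outer_variation_glb => V _; exact: variationS.
Qed.

Lemma outer_variation_ge0 A : 0 <= outer_variation A.
Proof. by apply: outer_variation_glb => U _ _; exact: variation_ge0. Qed.

Lemma outer_variationS A B : A `<=` B -> outer_variation A <= outer_variation B.
Proof.
move=> AB; apply: outer_variation_glb => U oU BU; apply: outer_variation_le => //.
exact: subset_trans BU.
Qed.

Lemma outer_variation0 : outer_variation set0 = 0.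
Proof. by rewrite outer_variation_open ?variation0//; exact: open0. Qed.

Lemma outer_variation_adherent A (e : R) : 0 < e ->
  exists U, [/\ open U, A `<=` U & variation U <= outer_variation A + e].
Proof.
move=> e0; have [_ [U [oU AU] <-] h] := inf_adherent e0 (has_inf_outer_variation A).
by exists U; split=> //; exact: ltW.
Qed.

Lemma outer_variation_sigma_subadditive :
  sigma_subadditive (fun A => (outer_variation A)%:E).
Proof.
move=> F; apply/lee_addgt0Pr => e e0.
have /choice[U hU] n : exists U, [/\ open U, F n `<=` U &
    variation U <= outer_variation (F n) + e / (2 ^ n.+1)%:R].
  by apply: outer_variation_adherent; rewrite divr_gt0// ltr0n expn_gt0.
have oU n : open (U n) by have [] := hU n.
apply: (@le_trans _ _ (variation (\bigcup_n U n))%:E).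
  rewrite lee_fin; apply: outer_variation_le; first exact: bigcup_open.
  by apply: subset_bigcup => n _; have [] := hU n.
apply: le_trans (variation_bigcup oU) _.
apply: le_trans (epsilon_trick xpredT _ (ltW e0)); last first.
  by move=> n; rewrite lee_fin outer_variation_ge0.
apply: lee_nneseries => [n _|n _]; first by rewrite lee_fin variation_ge0.
by rewrite -EFinD lee_fin; have [] := hU n.
Qed.

Definition outer_variation_measure : {outer_measure set T -> \bar R} :=
  HB.pack (fun A : set T => (outer_variation A)%:E)
    (isOuterMeasure.Build R T (fun A : set T => (outer_variation A)%:E)
      (congr1 EFin outer_variation0) (fun A => outer_variation_ge0 A)
      (fun A B AB => outer_variationS AB) outer_variation_sigma_subadditive).

(** A test function for $V \cap U$ can be taken to live on a closed set $F$ inside $U$;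
    added to a test function for $V \setminus F$, it is still bounded by 1. *)
Lemma outer_variation_split X U : open U ->
  outer_variation (X `&` U) + outer_variation (X `&` ~` U) <= outer_variation X.
Proof.
move=> oU; apply: outer_variation_glb => V oV XV.
apply: (@ler_addmul_gt0 _ _ _ (rnorm Lam + 2)); first by rewrite addr_ge0 ?rnorm_ge0.
move=> e e0.
have [g [a [gVU ga Lg]]] := variation_adherent (V `&` U) e0.
have [g' [F [cF FVU [g'1 g'0] gg']]] := test_function_shrink e0 gVU.
have [h [b [[h1 h0] hb Lh]]] := variation_adherent (V `&` ~` F) e0.
have XU : outer_variation (X `&` U) <= variation (V `&` U).
  by apply: outer_variation_le; [exact: openI|exact: setSI].
have XnU : outer_variation (X `&` ~` U) <= variation (V `&` ~` F).
  apply: outer_variation_le; first by apply: openI => //; exact: closed_openC.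
  by apply: setISS => //; apply: subsetC => x /FVU[].
have gh : rnorm (Lam (g' + h)) <= variation V.
  apply: variation_ub; split=> x; rewrite cfunD.
    have [Fx|/g'0 ->] := pselect (F x); last by rewrite add0r.
    by rewrite [h x]h0 ?addr0// => -[].
  move=> nV; rewrite g'0; last by move=> /FVU[].
  by rewrite add0r h0// => -[].
have : a + b <= rnorm (Lam (g' + h)) + e * rnorm Lam.
  apply: (le_trans (ler_norm _)); rewrite -(@rnorm_ofR R k) ofRD -Lg -Lh.
  have -> : Lam g + Lam h = Lam (g' + h) + Lam (g - g').
    by rewrite -!linearD [g' + h + _]addrAC [g' + (g - g')]addrC subrK.
  by apply: le_trans (rnormD _ _) _; rewrite lerD2l.
move: ga hb XU XnU gh; rewrite mulrDr; lra.
Qed.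

Lemma borel_caratheodory A : borel A -> outer_variation_measure.-caratheodory A.
Proof.
apply: smallest_sub => [|U oU]; last first.
  apply: le_caratheodory_measurable => X; rewrite -EFinD lee_fin.
  exact: outer_variation_split.
split=> [|B mB|F mF].
- exact: caratheodory_measurable_set0.
- by rewrite setTD; exact: caratheodory_measurable_setC.
- exact: caratheodory_measurable_bigcup.
Qed.

Lemma outer_variationU A B : borel A -> borel B -> A `&` B = set0 ->
  outer_variation (A `|` B) = outer_variation A + outer_variation B.
Proof.
move=> /borel_caratheodory mA _ AB; have := mA (A `|` B).
rewrite /= -EFinD => -[->]; congr (outer_variation _ + outer_variation _).
  by apply/setIidPr; exact: subsetUl.
by rewrite -setDE setDUl setDv set0U setDidl// setIC.
Qed.

End variation_of_open_sets.

(** * Riesz representation: existence *)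

Section riesz_existence.
Context {R : realType} {k : scalar_kind} {T : topologicalType}.
Local Notation K := (scalars R k).
Variable cT : compact [set: T].
Hypothesis hT : hausdorff_space T.
Local Notation C := (continuous_fun R k cT).
Variable Lam : dual C.
Local Notation mu := (outer_variation Lam).
Implicit Types (E F G : set T) (f g : C).

Lemma additive_outer_variation :
  @vector_measure R RealScalars T (scalars R RealScalars)^o mu.
Proof. by move=> A B; exact: outer_variationU. Qed.

(** Countable subadditivity and finite additivity together: the partial sums of the
    measures come within $e$ of the measure of the union. *)
Lemma outer_variation_tail (E : nat -> set T) : (forall n, borel (E n)) ->
  trivIset setT E -> forall e : R, 0 < e -> exists N, forall n, (N <= n)%N ->
    mu (\bigcup_i E i `\` \bigcup_(i in [set` iota 0 n]) E i) <= e.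
Proof.
move=> bE tE e e0.
have bU n : borel (\bigcup_(i in [set` iota 0 n]) E i) by exact: borel_bigcup_seq.
have sub n : \bigcup_(i in [set` iota 0 n]) E i `<=` \bigcup_i E i.
  by move=> x [i _ ?]; exists i.
have [N hN] : exists N, mu (\bigcup_i E i) - e <= \sum_(0 <= i < N) mu (E i).
  apply: contrapT => /forallNP h.
  have := outer_variation_sigma_subadditive hT Lam E.
  apply/negP; rewrite -ltNge; apply: (@le_lt_trans _ _ (mu (\bigcup_i E i) - e)%:E); last first.
    by rewrite lte_fin gtrBl.
  apply: lime_le; first by apply: is_cvg_nneseries => n _ _; rewrite lee_fin outer_variation_ge0.
  by near=> n; rewrite sumEFin lee_fin; have /negP := h n; rewrite -ltNge => /ltW.
exists N => n Nn.
have -> := vector_measureD additive_outer_variation (borel_bigcup bE) (bU n) (sub n).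
rewrite lerBlDl -lerBlDr; apply: (le_trans hN).
rewrite /index_iota subn0.
have <- : mu (\bigcup_(i in [set` iota 0 N]) E i) = \sum_(i <- iota 0 N) mu (E i).
  exact: (vector_measure_seq additive_outer_variation (iota_uniq 0 N) bE tE).
apply: outer_variationS => x [i iN Eix]; exists i => //.
move: iN; rewrite /mkset !mem_iota !add0n /= => iN; exact: leq_trans Nn.
Unshelve. all: by end_near. Qed.

(** Outer regularity holds by construction; inner regularity is outer regularity of the
    complement. *)
Lemma outer_variation_regular E (e : R) : borel E -> 0 < e ->
  exists F G, [/\ closed F, open G, F `<=` E, E `<=` G & mu (G `\` F) <= e].
Proof.
move=> bE e0; have e20 : 0 < e / 2 by rewrite divr_gt0.
have [U [oU EU hU]] := outer_variation_adherent Lam E e20.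
have [V [oV EV hV]] := outer_variation_adherent Lam (~` E) e20.
have VE : ~` V `<=` E by move=> x nV; apply: contrapT => /EV.
exists (~` V), U; split=> //; first exact: open_closedC.
have bU := borel_open oU; have bV := borel_open oV.
have -> : U `\` ~` V = (U `\` E) `|` (E `\` ~` V).
  apply/seteqP; split=> x /=; last by move=> [[? ?]|[/EU ? ?]]; split=> // /VE.
  by move=> [Ux Vx]; have [?|?] := pselect (E x); [right|left].
rewrite (outer_variationU hT)//; first last.
- by rewrite -subset0 => x [[_ ?] []].
- by apply: borelD => //; exact: borelC.
- exact: borelD.
have h1 : mu (U `\` E) = mu U - mu E.
  exact: (vector_measureD additive_outer_variation bU bE EU).
have h2 : mu (V `\` ~` E) = mu V - mu (~` E).
  exact: (vector_measureD additive_outer_variation bV (borelC bE) EV).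
rewrite h1 (_ : E `\` ~` V = V `\` ~` E); last by rewrite !setDE !setCK setIC.
rewrite h2 (outer_variation_open _ oU) (outer_variation_open _ oV).
move: hU hV; lra.
Qed.

Lemma outer_variation_dominates U g (M : R) : open U -> 0 < M ->
  (forall x, rnorm (g x : K^o) <= M) -> (forall x, ~ U x -> g x = 0) ->
  rnorm (Lam g) <= M * mu U.
Proof. by move=> oU *; rewrite (outer_variation_open _ oU) variation_scale. Qed.

Lemma outer_variation_bigU (I : eqType) (r : seq I) (U : I -> set T) :
  (forall i, open (U i)) ->
  mu (\bigcup_(i in [set` r]) U i) <= \sum_(i <- r) mu (U i).
Proof.
move=> oU; rewrite outer_variation_open; last exact: bigcup_open.
apply: le_trans (variation_bigU hT Lam r oU) _; apply: ler_sum => i _.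
by rewrite outer_variation_open.
Qed.

Lemma outer_variation_openU U V : open U -> open V -> mu (U `|` V) <= mu U + mu V.
Proof. by move=> oU oV; rewrite !outer_variation_open ?variationU//; exact: openU. Qed.

Definition sandwich F E G f :=
  [/\ closed F, open G, F `<=` E, E `<=` G & separates F G f].

Lemma exists_sandwich F E G : closed F -> open G -> F `<=` E -> E `<=` G ->
  exists f, sandwich F E G f.
Proof.
move=> cF oG FE EG; have [f hf] := @urysohn_cfun R k T cT F G hT cF oG (subset_trans FE EG).
by exists f.
Qed.

Lemma open_gap F E G f : sandwich F E G f -> open (G `\` F).
Proof. by move=> [cF oG _ _ _]; rewrite setDE; apply: openI => //; exact: closed_openC. Qed.

Lemma separates_on F G f x : separates F G f ->
  [/\ rnorm (f x : K^o) <= 1, F x -> f x = 1 & ~ G x -> f x = 0].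
Proof.
move=> [h [_ fh h01 h1 h0]]; rewrite fh; split.
- by rewrite rnorm_ofR; have /andP[? ?] := h01 x; rewrite ger0_norm.
- by move=> /h1 ->; rewrite ofR1.
- by move=> /h0 ->; rewrite ofR0.
Qed.

(** The two functions agree off the two gaps: both are 1 on the part of $E$ there, and
    0 elsewhere. *)
Lemma sandwich_dist F F' E G G' f f' : sandwich F E G f -> sandwich F' E G' f' ->
  rnorm (Lam f - Lam f') <= mu (G `\` F) + mu (G' `\` F').
Proof.
move=> s s'; have [_ _ FE EG sf] := s; have [_ _ FE' EG' sf'] := s'.
have oW := open_gap s; have oW' := open_gap s'.
apply: le_trans (outer_variation_openU oW oW').
rewrite -linearB -[leRHS]mul1r.
have [h [_ fh h01 _ _]] := sf; have [h' [_ fh' h01' _ _]] := sf'.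
apply: outer_variation_dominates => //; first exact: openU.
  move=> x; rewrite cfunB fh fh' -ofRB rnorm_ofR ler_norml.
  have := h01 x; have := h01' x => /andP[a b] /andP[c d].
  by apply/andP; split; lra.
move=> x nW; rewrite cfunB.
have [_ f1 f0] := separates_on x sf; have [_ f'1 f'0] := separates_on x sf'.
have [Ex|nEx] := pselect (E x).
  rewrite f1 ?f'1 ?subrr//; apply: contrapT => nF; apply: nW.
    by right; split=> //; exact: EG'.
  by left; split=> //; exact: EG.
rewrite f0 ?f'0 ?subrr// => Gx; apply: nW.
  by right; split=> // /FE'.
by left; split=> // /FE.
Qed.

(** The values of the functional at Urysohn functions with small gaps form a Cauchy
    net; a sequence with gaps below $1/(n+1)$ suffices to produce the limit. *)
Lemma exists_representing_value E : exists z : K^o, borel E ->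
  forall F G f, sandwich F E G f -> rnorm (z - Lam f) <= mu (G `\` F).
Proof.
have [bE|nbE] := pselect (borel E); last by exists 0 => /nbE.
have /choice[s hs] n : exists p : set T * set T * C,
    sandwich p.1.1 E p.1.2 p.2 /\ mu (p.1.2 `\` p.1.1) <= n.+1%:R^-1.
  have [|F [G [cF oG FE EG FG]]] := @outer_variation_regular E n.+1%:R^-1 bE.
    by rewrite invr_gt0.
  have [f sf] := exists_sandwich cF oG FE EG.
  by exists (F, G, f).
have [|z hz] := @banach_scalars R k (fun n => Lam (s n).2).
  move=> e e0; have [N hN] := invn_le (divr_gt0 e0 (ltr0Sn _ 1)).
  exists N => i j /hN hi /hN hj; have [si si'] := hs i; have [sj sj'] := hs j.
  apply: le_trans (sandwich_dist si sj) _; rewrite [e]splitr.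
  by apply: lerD; [exact: le_trans si' hi|exact: le_trans sj' hj].
exists z => _ F G f sf; apply/ler_addgt0Pr => e e0.
have e20 : 0 < e / 2 by rewrite divr_gt0.
move/cvgn_rnormP : hz => /(_ _ e20)[N1 hN1]; have [N2 hN2] := invn_le e20.
pose n := maxn N1 N2; have h1 := hN1 n (leq_maxl _ _); have h2 := hN2 n (leq_maxr _ _).
apply: le_trans (rnorm_triangle (Lam (s n).2) _ _) _.
have [sn sn'] := hs n; have := sandwich_dist sn sf.
move: (le_trans sn' h2) h1; lra.
Qed.

Definition riesz_measure : set T -> K^o :=
  projT1 (choice exists_representing_value).

Lemma riesz_measure_dist F E G f : borel E -> sandwich F E G f ->
  rnorm (riesz_measure E - Lam f) <= mu (G `\` F).
Proof.
by move=> bE; apply: (projT2 (choice exists_representing_value)).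
Qed.

Lemma riesz_measure_le E : borel E -> rnorm (riesz_measure E) <= mu E.
Proof.
move=> bE; apply: (@ler_addmul_gt0 _ _ _ 2) => // e e0.
have [F [G [cF oG FE EG FG]]] := outer_variation_regular bE e0.
have [f sf] := exists_sandwich cF oG FE EG.
have h := riesz_measure_dist bE sf.
have [_ _ _ _ sep] := sf.
have Lf : rnorm (Lam f) <= mu G.
  rewrite -[leRHS]mul1r; apply: outer_variation_dominates => // x.
    by have [] := separates_on x sep.
  by have [] := separates_on x sep.
have GE : mu (G `\` E) = mu G - mu E.
  exact: (vector_measureD additive_outer_variation (borel_open oG) bE EG).
have GE' : mu (G `\` E) <= mu (G `\` F).
  by apply: outer_variationS => x [Gx nE]; split=> // /FE.
have := rnorm_le_dist (riesz_measure E) (Lam f); lra.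
Qed.

(** If $f_1$, $f_2$ and $f$ are Urysohn functions for the two sets and their union, then
    $f - f_1 - f_2$ vanishes off the two gaps, because the inner closed sets are disjoint. *)
Lemma riesz_measure_additive : vector_measure riesz_measure.
Proof.
move=> E1 E2 bE1 bE2 E12; apply/eqP; rewrite -subr_eq0; apply/eqP.
apply: (@rnorm_eq0_small _ _ _ _ 10) => // e e0.
have [F1 [G1 [cF1 oG1 FE1 EG1 FG1]]] := outer_variation_regular bE1 e0.
have [F2 [G2 [cF2 oG2 FE2 EG2 FG2]]] := outer_variation_regular bE2 e0.
have [f1 s1] := exists_sandwich cF1 oG1 FE1 EG1.
have [f2 s2] := exists_sandwich cF2 oG2 FE2 EG2.
have [|||| f s] := @exists_sandwich (F1 `|` F2) (E1 `|` E2) (G1 `|` G2).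
- exact: closedU.
- exact: openU.
- exact: setUSS.
- exact: setUSS.
have d1 := riesz_measure_dist bE1 s1; have d2 := riesz_measure_dist bE2 s2.
have d := riesz_measure_dist (borelU bE1 bE2) s.
have oW1 := open_gap s1; have oW2 := open_gap s2.
set W := (G1 `\` F1) `|` (G2 `\` F2).
have oW : open W by exact: openU.
have mW : mu W <= e + e.
  by apply: le_trans (outer_variation_openU oW1 oW2) _; rewrite lerD.
have mG : mu ((G1 `|` G2) `\` (F1 `|` F2)) <= mu W.
  apply: outer_variationS => x [[G1x|G2x] nF].
    by left; split=> // ?; apply: nF; left.
  by right; split=> // ?; apply: nF; right.
have [_ _ _ _ p] := s; have [_ _ _ _ p1] := s1; have [_ _ _ _ p2] := s2.
(* The constant 3 only comes from the triangle inequality on the gaps. *)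
have dL : rnorm (Lam (f - f1 - f2)) <= 3 * mu W.
  apply: outer_variation_dominates => // x; rewrite !cfunB.
    apply: le_trans (rnormB _ _) _.
    have := rnormB (f x : K^o) (f1 x).
    have [a _ _] := separates_on x p; have [b _ _] := separates_on x p1.
    have [c _ _] := separates_on x p2; move: a b c; lra.
  move=> nW; have [_ a1 a0] := separates_on x p.
  have [_ b1 b0] := separates_on x p1; have [_ c1 c0] := separates_on x p2.
  have nW1 : ~ (G1 `\` F1) x by move=> ?; apply: nW; left.
  have nW2 : ~ (G2 `\` F2) x by move=> ?; apply: nW; right.
  have [F1x|nF1] := pselect (F1 x).
    rewrite a1 ?b1 ?c0 ?subrr ?subr0//; last by left.
    move=> G2x; have F2x : F2 x by apply: contrapT => ?; apply: nW2.
    have : (E1 `&` E2) x by split; [exact: FE1|exact: FE2].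
    by rewrite E12.
  have nG1 : ~ G1 x by move=> ?; apply: nW1.
  have [F2x|nF2] := pselect (F2 x).
    by rewrite a1 ?b0 ?c1 ?subr0 ?subrr//; right.
  have nG2 : ~ G2 x by move=> ?; apply: nW2.
  by rewrite a0 ?b0 ?c0 ?subr0// => -[].
have -> : riesz_measure (E1 `|` E2) - (riesz_measure E1 + riesz_measure E2) =
    (riesz_measure (E1 `|` E2) - Lam f) + Lam (f - f1 - f2)
    - ((riesz_measure E1 - Lam f1) + (riesz_measure E2 - Lam f2)).
  by rewrite !linearB /=; ring.
have := rnormB ((riesz_measure (E1 `|` E2) - Lam f) + Lam (f - f1 - f2))
  ((riesz_measure E1 - Lam f1) + (riesz_measure E2 - Lam f2)).
have := rnormD (riesz_measure (E1 `|` E2) - Lam f) (Lam (f - f1 - f2)).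
have := rnormD (riesz_measure E1 - Lam f1) (riesz_measure E2 - Lam f2).
lra.
Qed.

Lemma riesz_measure_regular : regular riesz_measure.
Proof.
move=> E bE e e0; have [F [G [cF oG FE EG FG]]] :=
  outer_variation_regular bE (divr_gt0 e0 (ltr0Sn _ 1)).
exists F, G; split=> // B bB /(outer_variationS Lam) BFG.
have := riesz_measure_le bB; move: BFG FG e0; lra.
Qed.

Lemma riesz_measure_countably_additive : countably_additive riesz_measure.
Proof.
move=> E bE tE; apply/cvgn_rnormP => e e0.
have [N hN] := outer_variation_tail bE tE e0; exists N => n /hN h.
have bU : borel (\bigcup_(i in [set` iota 0 n]) E i) by exact: borel_bigcup_seq.
rewrite /series /= /index_iota subn0.
rewrite -(vector_measure_seq riesz_measure_additive (iota_uniq 0 n) bE tE).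
rewrite -(vector_measureD riesz_measure_additive)//; first last.
- by move=> x [i _ ?]; exists i.
- exact: borel_bigcup.
apply: le_trans h; apply: riesz_measure_le; apply: borelD => //.
exact: borel_bigcup.
Qed.

Lemma riesz_measure_semivariation : (semivariation riesz_measure <= (rnorm Lam)%:E)%E.
Proof.
apply: ge_ereal_sup => _ [n [E [eps [bE tE _ eps1 ->]]]]; rewrite lee_fin.
apply: le_trans (rnorm_sum _ _ _) _.
apply: (@le_trans _ _ (\sum_(i < n) mu (E i))).
  apply: ler_sum => i _; rewrite rnormZ -[leRHS]mul1r.
  apply: ler_pM; rewrite ?rnorm_ge0 ?riesz_measure_le//.
  by rewrite -(@ler_rnorm R k K^o) ofR1; exact: eps1.
have <- : mu (\bigcup_(i in [set` xpredT]) E i) = \sum_(i < n) mu (E i).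
  exact: (vector_measure_pred additive_outer_variation xpredT bE tE).
apply: (@le_trans _ _ (mu setT)); first by apply: outer_variationS => ? _.
by rewrite outer_variation_open ?variation_le//; exact: openT.
Qed.

(** The radial truncation at level $d$ carries the values off $U$, and the rest of $g$
    vanishes off $U$. *)
Lemma truncated_bound U g (d M : R) : open U -> 0 < d -> 0 < M ->
  (forall x, rnorm (g x : K^o) <= M) -> (forall x, ~ U x -> rnorm (g x : K^o) <= d) ->
  rnorm (Lam g) <= d * rnorm Lam + M * mu U.
Proof.
move=> oU d0 M0 gM gd; have [t tE] := radial_truncation g d0.
have -> : Lam g = Lam t + Lam (g - t) by rewrite -linearD addrC subrK.
apply: le_trans (rnormD _ _) _; apply: lerD.
  apply: le_trans (rnorm_blin_le _ _) _; rewrite mulrC ler_wpM2r ?rnorm_ge0//.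
  by apply: rnorm_cfun_lub; [exact: ltW|move=> x; have [] := tE x].
apply: outer_variation_dominates => // x; rewrite cfunB.
  by have [_ _ h] := tE x; exact: le_trans (gM x).
by move=> /gd h; have [_ -> //] := tE x; rewrite subrr.
Qed.

(** With $f$ within $d$ of the step function $\sum c_i 1_{E_i}$ and $f_i$ a Urysohn
    function for $E_i$, the continuous function $f - \sum c_i f_i$ is bounded by $d$ off
    the union of the gaps, which is small. *)
Lemma riesz_measure_integral f : integral_value riesz_measure (rnorm Lam) f (Lam f).
Proof.
move=> d s d0 /borel_simple_step[I [E [c [pE sE]]]] fs.
rewrite (simple_integral_step riesz_measure_additive pE sE).
have [bE tE cE] := pE.
pose S := \sum_i rnorm (c i : K^o).
have S0 : 0 <= S by apply: sumr_ge0 => i _; exact: rnorm_ge0.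
(* A bound for f minus the sum below on the whole space; the 1 makes it positive. *)
pose M := rnorm f + S + 1.
have M0 : 0 < M by rewrite ltr_wpDl// addr_ge0 ?rnorm_ge0.
apply: (@ler_addmul_gt0 _ _ _ (M * #|I|%:R + S)).
  by rewrite addr_ge0// mulr_ge0// ltW.
move=> e e0.
have /choice[p hp] i : exists p : set T * set T * C,
    sandwich p.1.1 (E i) p.1.2 p.2 /\ mu (p.1.2 `\` p.1.1) <= e.
  have [F [G [cF oG FE EG FG]]] := outer_variation_regular (bE i) e0.
  have [h sh] := exists_sandwich cF oG FE EG.
  by exists (F, G, h).
pose W i := (p i).1.2 `\` (p i).1.1.
have oW i : open (W i) by have [/open_gap] := hp i.
pose U := \bigcup_(i in [set` enum I]) W i.
have mU : mu U <= e * #|I|%:R.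
  apply: le_trans (outer_variation_bigU _ oW) _.
  rewrite big_enum /=; apply: (@le_trans _ _ (\sum_(i : I) e)).
    by apply: ler_sum => i _; have [] := hp i.
  by rewrite sumr_const mulr_natr.
pose g : C := f - \sum_i c i *: (p i).2.
have gE x : g x = f x - \sum_i c i * (p i).2 x by rewrite /g cfunB cfun_sum.
have Lg : rnorm (Lam g) <= d * rnorm Lam + M * mu U.
  apply: truncated_bound => //; first by apply: bigcup_open => i _; exact: oW.
    move=> x; rewrite gE; apply: le_trans (rnormB _ _) _.
    rewrite /M -addrA; apply: lerD; first exact: rnorm_cfun_ub.
    apply: (@le_trans _ _ S); last by rewrite lerDl.
    apply: le_trans (rnorm_sum _ _ _) _; apply: ler_sum => i _.
    have [[_ _ _ _ sp] _] := hp i; have [p1 _ _] := separates_on x sp.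
    by rewrite rnormM ler_piMr ?rnorm_ge0.
  move=> x nU; have [j Ejx] := cE x.
  have nW i : ~ W i x by move=> ?; apply: nU; exists i => //=; rewrite mem_enum.
  have -> : g x = f x - s x; last exact: fs.
  rewrite gE (sE _ _ Ejx) (bigD1 j)//= big1 ?addr0 => [|i ij].
    have [[_ _ _ EG sp] _] := hp j; have [_ p1 _] := separates_on x sp.
    rewrite p1 ?mulr1//; apply: contrapT => nF; apply: (nW j).
    by split=> //; exact: EG.
  have [[_ _ FE _ sp] _] := hp i; have [_ _ p0] := separates_on x sp.
  rewrite p0 ?mulr0// => Gx; apply: (nW i); split=> // /FE Eix.
  have : i = j by apply: (tE _ _ Logic.I Logic.I); exists x.
  by move/eqP; rewrite (negbTE ij).
have -> : Lam f - \sum_i c i *: riesz_measure (E i) =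
    Lam g - \sum_i c i *: (riesz_measure (E i) - Lam (p i).2).
  have -> : Lam g = Lam f - \sum_i c i *: Lam (p i).2.
    rewrite /g linearB linear_sum /=; congr (Lam f - _).
    by apply: eq_bigr => i _; rewrite linearZ.
  rewrite -addrA -opprD -big_split /=; congr (Lam f - _).
  by apply: eq_bigr => i _; rewrite scalerBr addrC subrK.
apply: le_trans (rnormB _ _) _.
have hS : rnorm (\sum_i c i *: (riesz_measure (E i) - Lam (p i).2)) <= e * S.
  apply: le_trans (rnorm_sum _ _ _) _; rewrite mulr_sumr; apply: ler_sum => i _.
  rewrite rnormZ mulrC ler_wpM2r ?rnorm_ge0//.
  by have [sp h] := hp i; exact: le_trans (riesz_measure_dist (bE i) sp) h.
apply: le_trans (lerD Lg hS) _; rewrite -addrA lerD2l mulrDr lerD2r.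
by rewrite mulrCA ler_wpM2l ?(ltW M0).
Qed.

End riesz_existence.

(** * Riesz representation: uniqueness *)

Section riesz_uniqueness.
Context {R : realType} {k : scalar_kind} {T : topologicalType}.
Local Notation K := (scalars R k).

Lemma semivariation_fine (Z : normedModType K) (m : set T -> Z) :
  (semivariation m < +oo)%E -> semivariation m = (fine (semivariation m))%:E.
Proof. by move=> mf; rewrite fineK// ge0_fin_numE// semivariation_ge0. Qed.

(** The norm is convex in each coefficient separately, so its maximum over coefficients
    in $[0,1]$ is attained when all of them are 0 or 1, that is at a partial sum.  This
    bounds an integral over a gap by the values of the measure alone. *)
Lemma convex_sum_le (V : normedModType K) (I : eqType) (r : seq I) (h : I -> R)
    (z : I -> V) (w : V) (e : R) : uniq r -> (forall i, 0 <= h i <= 1) ->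
  (forall P : pred I, rnorm (w + \sum_(i <- r | P i) z i) <= e) ->
  rnorm (w + \sum_(i <- r) ofR (h i) *: z i) <= e.
Proof.
move=> + h01; elim: r w => [|a r IH] w.
  by move=> _ /(_ xpredT); rewrite !big_nil.
rewrite [uniq _]/= big_cons => /andP[ar ur] he.
have hP (P : pred I) : \sum_(i <- r | P i && (i != a)) z i = \sum_(i <- r | P i) z i.
  rewrite big_seq_cond [RHS]big_seq_cond; apply: eq_bigl => i.
  case: eqVneq => [->|_]; first by rewrite (negbTE ar).
  by rewrite andbT.
have h0 : rnorm (w + \sum_(i <- r) ofR (h i) *: z i) <= e.
  apply: IH => // P; have := he (fun i => P i && (i != a)).
  by rewrite big_cons eqxx andbF hP.
have h1 : rnorm ((w + z a) + \sum_(i <- r) ofR (h i) *: z i) <= e.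
  apply: IH => // P; have := he (fun i => P i || (i == a)).
  have -> : \sum_(i <- a :: r | P i || (i == a)) z i = z a + \sum_(i <- r | P i) z i.
    rewrite big_cons eqxx orbT; congr (_ + _); rewrite -[LHS]hP -[RHS]hP.
    by apply: eq_bigl => i; case: (i == a); rewrite /= !(andbF, andbT, orbF).
  by rewrite addrA.
have /andP[ha0 ha1] := h01 a.
have -> : w + (ofR (h a) *: z a + \sum_(i <- r) ofR (h i) *: z i) =
  ofR (1 - h a) *: (w + \sum_(i <- r) ofR (h i) *: z i) +
  ofR (h a) *: ((w + z a) + \sum_(i <- r) ofR (h i) *: z i).
  set s := \sum_(i <- r) _; rewrite ofRB ofR1 scalerBl scale1r [w + z a + s]addrAC.
  by rewrite [_ *: (w + s + z a)]scalerDr [RHS]addrA subrK addrA addrAC.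
apply: le_trans (rnormD _ _) _; rewrite !rnormZ !rnorm_ofR !ger0_norm ?subr_ge0//.
have e1 : e = (1 - h a) * e + h a * e by rewrite -mulrDl subrK mul1r.
by rewrite [leRHS]e1 lerD// ler_wpM2l ?subr_ge0.
Qed.

Variable cT : compact [set: T].
Hypothesis hT : hausdorff_space T.
Local Notation C := (continuous_fun R k cT).

Lemma approximable_cfun (f : C) : approximable f.
Proof. by apply: approximable_continuous => //; exact: cfun_continuous. Qed.

(** Up to a uniform error, $f$ is a step function equal to 1 on $F$, to 0 off $G$, and
    with values in $[0,1]$ on a partition of the gap; the last part is estimated by
    [convex_sum_le]. *)
Lemma sandwich_integral (nu : set T -> K^o) (M e : R) (E F G : set T) (f : C) :
  vector_measure nu -> (semivariation nu <= M%:E)%E -> borel E ->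
  sandwich F E G f -> (forall B, borel B -> B `<=` G `\` F -> rnorm (nu B) <= e) ->
  rnorm (vintegral nu f - nu E) <= e + e.
Proof.
move=> am nM bE [cF oG FE EG [h [_ fh h01 h1 h0]]] he.
have bF := borel_closed cF; have bG := borel_open oG.
have M0 := semivariation_bound_ge0 nM.
apply: (@ler_addmul_gt0 _ _ _ (2 * M)); first by rewrite mulr_ge0.
move=> d d0; have [s [/borel_simple_step[I [P [c [pP sP]]]] fs]] := approximable_cfun f d0.
have [bP tP cP] := pP.
(* The given step values are replaced by values of f itself, which lie in the unit
   interval; this doubles the error. *)
have /choice[v hv] i : exists v : R, 0 <= v <= 1 /\
    forall x, P i x -> rnorm (f x - ofR v : K^o) <= 2 * d.
  have [P0|/set0P[y Py]] := eqVneq (P i) set0.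
    by exists 0; split; [rewrite lexx ler01|move=> x; rewrite P0].
  exists (h y); split=> // x Px; rewrite -fh.
  apply: le_trans (rnorm_triangle (s x : K^o) _ _) _.
  rewrite mulr2n mulrDl mul1r lerD// (sP _ _ Px) -(sP _ _ Py).
  by rewrite rnorm_distC.
(* The indices true and false stand for F and the complement of G; the others cut up
   the gap. *)
pose Q (j : bool + I) := match j with
  | inl true => F | inl false => ~` G | inr i => P i `&` (G `\` F) end.
pose a (j : bool + I) : K := match j with
  | inl true => 1 | inl false => 0 | inr i => ofR (v i) end.
have pQ : borel_partition Q.
  split=> [[[]|i]//=|[[]|i] [[]|j] _ _ [x []]//=|x].
  - exact: borelC.
  - by apply: borelI => //; exact: borelD.
  - by move=> /FE/EG.
  - by move=> Fx [_ []].
  - by move=> nG /FE/EG.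
  - by move=> nG [_ []].
  - by move=> [_ []].
  - by move=> [_ []].
  - move=> [Pi _] [Pj _]; congr inr; by apply: (tP _ _ Logic.I Logic.I); exists x.
  - have [Fx|nF] := pselect (F x); first by exists (inl true).
    have [Gx|nG] := pselect (G x); last by exists (inl false).
    by have [i Pi] := cP x; exists (inr i).
have [t tQ] := borel_partition_step a pQ.
have ft x : rnorm (f x - t x : K^o) <= 2 * d.
  have d20 : 0 <= 2 * d by rewrite mulr_ge0// ltW.
  have [_ _ /(_ x)[j Qj]] := pQ; rewrite (tQ _ _ Qj).
  case: j Qj => [[]|i] /= Qx.
  - by rewrite fh h1// ofR1 subrr rnorm0.
  - by rewrite fh h0// ofR0 subrr rnorm0.
  - by have [_ h'] := hv i; apply: h'; case: Qx.
have := vintegral_value am nM banach_scalars (approximable_cfun f).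
have d20 : 0 < 2 * d by rewrite mulr_gt0.
move=> /(_ _ _ d20 (step_borel_simple pQ tQ) ft).
rewrite (simple_integral_step am pQ tQ) big_sumType big_bool /=.
rewrite scale1r scale0r addr0 -mulrA [d * _]mulrC mulrA.
set S := \sum_(i : I) _ => hS.
have S_le : rnorm S <= e.
  rewrite -[S]add0r; apply: convex_sum_le => [|i|p].
  - exact: index_enum_uniq.
  - by have [] := hv i.
  - rewrite add0r -(@vector_measure_pred _ _ _ _ _ am _ p (fun i => P i `&` (G `\` F))).
    + apply: he; last by move=> x [i _ []].
      rewrite finite_union_pred; apply: borel_bigcup_seq => i.
      by apply: borelI => //; exact: borelD.
    + by move=> i; apply: borelI => //; exact: borelD.
    + move=> i j _ _ [x [[Pi _] [Pj _]]].
      by apply: (tP _ _ Logic.I Logic.I); exists x.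
have EF : nu (E `\` F) = nu E - nu F by exact: vector_measureD.
have EF_le : rnorm (nu E - nu F) <= e.
  by rewrite -EF; apply: he; [exact: borelD|move=> x [Ex nF]; split=> //; exact: EG].
have -> : vintegral nu f - nu E = (vintegral nu f - (nu F + S)) + (S - (nu E - nu F)).
  by rewrite opprB opprD; ring.
apply: le_trans (rnormD _ _) _; have := rnormB S (nu E - nu F).
move: hS S_le EF_le; rewrite mulrC mulrCA -!mulrA; lra.
Qed.

Definition represents (nu : set T -> K^o) (Lam : dual C) :=
  [/\ vector_measure nu, (semivariation nu < +oo)%E, regular nu &
      forall f : C, Lam f = vintegral nu f].

(** The approximation persists for smaller gaps, which is what allows Urysohn
    functions common to several measures. *)
Lemma represents_sandwich (nu : set T -> K^o) (Lam : dual C) E (e : R) :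
  represents nu Lam -> borel E -> 0 < e ->
  exists F G, [/\ closed F, open G, F `<=` E, E `<=` G &
    forall F' G' f, F `<=` F' -> G' `<=` G -> sandwich F' E G' f ->
      rnorm (Lam f - nu E) <= e].
Proof.
move=> [am nf rn Lf] bE e0.
have [F [G [cF oG FE EG h]]] := rn E bE (e / 2) (divr_gt0 e0 (ltr0Sn _ 1)).
exists F, G; split=> // F' G' f FF' GG' s; rewrite Lf [leRHS]splitr.
apply: (@sandwich_integral nu (fine (semivariation nu)) _ E F' G') => //.
  by rewrite -semivariation_fine.
move=> B bB BFG; apply/ltW/h => // x /BFG[Gx nF]; split; first exact: GG'.
by move=> /FF'.
Qed.

Lemma common_sandwich E F1 G1 F2 G2 F3 G3 :
  closed F1 -> open G1 -> F1 `<=` E -> E `<=` G1 ->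
  closed F2 -> open G2 -> F2 `<=` E -> E `<=` G2 ->
  closed F3 -> open G3 -> F3 `<=` E -> E `<=` G3 ->
  exists F G (f : C), [/\ sandwich F E G f, F1 `|` F2 `|` F3 `<=` F &
    G `<=` G1 `&` G2 `&` G3].
Proof.
move=> cF1 oG1 FE1 EG1 cF2 oG2 FE2 EG2 cF3 oG3 FE3 EG3.
have [||||f sf] := @exists_sandwich R k T cT hT (F1 `|` F2 `|` F3) E (G1 `&` G2 `&` G3).
- by apply: closedU => //; exact: closedU.
- by apply: openI => //; exact: openI.
- by move=> x [[/FE1|/FE2]|/FE3].
- by move=> x Ex; split; [split; [exact: EG1|exact: EG2]|exact: EG3].
- by exists (F1 `|` F2 `|` F3), (G1 `&` G2 `&` G3), f; split.
Qed.

(** Stated for three separate measures: the linear combination is formed on the side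
    of the functionals, at a common Urysohn function, so that sums of regular measures
    never have to be shown regular. *)
Lemma represents_linear (nu nu1 nu2 : set T -> K^o) (Lam Lam1 Lam2 : dual C) (c : K) E :
  represents nu Lam -> represents nu1 Lam1 -> represents nu2 Lam2 ->
  (forall f, Lam f = c *: Lam1 f + Lam2 f) -> borel E ->
  nu E = c *: nu1 E + nu2 E.
Proof.
move=> r r1 r2 LE bE; apply/eqP; rewrite -subr_eq0; apply/eqP.
apply: (@rnorm_eq0_small _ _ _ _ (rnorm (c : K^o) + 2)).
  by rewrite addr_ge0// rnorm_ge0.
move=> e e0.
have [F1 [G1 [cF1 oG1 FE1 EG1 h1]]] := represents_sandwich r1 bE e0.
have [F2 [G2 [cF2 oG2 FE2 EG2 h2]]] := represents_sandwich r2 bE e0.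
have [F3 [G3 [cF3 oG3 FE3 EG3 h3]]] := represents_sandwich r bE e0.
have [F [G [f [sf FF GG]]]] := common_sandwich cF1 oG1 FE1 EG1 cF2 oG2 FE2 EG2 cF3 oG3 FE3 EG3.
have {}h1 : rnorm (Lam1 f - nu1 E) <= e.
  by apply: (h1 F G) => // x; [move=> ?; apply: FF; left; left|move=> /GG[[]]].
have {}h2 : rnorm (Lam2 f - nu2 E) <= e.
  by apply: (h2 F G) => // x; [move=> ?; apply: FF; left; right|move=> /GG[[]]].
have {}h3 : rnorm (Lam f - nu E) <= e.
  by apply: (h3 F G) => // x; [move=> ?; apply: FF; right|move=> /GG[]].
have -> : nu E - (c *: nu1 E + nu2 E) =
    c *: (Lam1 f - nu1 E) + (Lam2 f - nu2 E) - (Lam f - nu E).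
  by rewrite LE scalerBr /GRing.scale /=; ring.
apply: le_trans (rnormB _ _) _; have := rnormD (c *: (Lam1 f - nu1 E)) (Lam2 f - nu2 E).
rewrite rnormZ mulrDl.
have := ler_wpM2l (rnorm_ge0 (c : K^o)) h1.
move: h2 h3; lra.
Qed.

Lemma represents_unique (nu nu' : set T -> K^o) (Lam : dual C) E :
  represents nu Lam -> represents nu' Lam -> borel E -> nu E = nu' E.
Proof.
move=> r r' bE.
have h := represents_linear (c := 0) r r r' _ bE.
by rewrite h ?scale0r ?add0r// => f; rewrite scale0r add0r.
Qed.

Lemma riesz_represents (Lam : dual C) : represents (riesz_measure hT Lam) Lam.
Proof.
have am := riesz_measure_additive hT Lam; have nM := riesz_measure_semivariation hT Lam.
split=> //; first exact: le_lt_trans nM (ltry _).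
  exact: riesz_measure_regular.
move=> f; apply/esym/(vintegral_eq nM (approximable_cfun f)).
exact: riesz_measure_integral.
Qed.

End riesz_uniqueness.

(** * Weak*-continuous functionals and the projective tensor product *)

Section weak_star_functionals.
Context {R : realType} {k : scalar_kind}.
Local Notation K := (scalars R k).
Implicit Types U V : normedModType K.

(** The weak* topology is induced from a product; both directions only unfold this, and
    reduce weak* continuity to evaluations at vectors. *)
Lemma weak_star_cvgP U (F : set_system (dual U)) (l : dual U) : Filter F ->
  F --> (l : weak_star U) <-> forall u, (fun f : dual U => f u) @ F --> (l u : K^o).
Proof.
move=> FF; split=> [Fl u|Fl].
  apply: (@cvg_comp _ _ _ (fun f : dual U => f : {ptws U -> K^o})
    (fun h : {ptws U -> K^o} => h u) F (nbhs (l : {ptws U -> K^o}))); last first.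
    exact: (@proj_continuous U (fun=> K^o) u (l : {ptws U -> K^o})).
  apply: cvg_trans (@initial_continuous _ _ (fun f : dual U => f : {ptws U -> K^o}) l).
  exact: cvg_app.
have ptFl : (fun f : dual U => f : {ptws U -> K^o}) @ F --> (l : {ptws U -> K^o}).
  apply/cvg_sup => u B [A [[W oW <-]] Wl] /filterS; apply.
  by apply: (Fl u); exact: open_nbhs_nbhs.
move=> B [A [[W oW <-]] Wl] /filterS; apply.
by apply: ptFl; exact: open_nbhs_nbhs.
Qed.

(** By induction on $D$: a functional $f_0$ vanishing on the rest of $D$ but not under
    $l$ is nonzero at the head $a$, and subtracting a multiple of evaluation at $a$ from
    $l$ removes $a$ from the list. *)
Lemma kernel_functional U (D : seq U) (l : dual U -> K^o) : linear l ->
  (forall f : dual U, (forall u, u \in D -> f u = 0) -> l f = 0) ->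
  exists u, forall f : dual U, l f = f u.
Proof.
elim: D l => [|a D IH] l ll lD.
  by exists 0 => f; rewrite lD// linear0.
have [h|/existsNP[f0 /not_implyP[f0D /eqP lf0]]] := pselect
    (forall f : dual U, (forall u, u \in D -> f u = 0) -> l f = 0).
  exact: IH.
have l0 : l 0 = 0 by have := ll (-1) 0 0; rewrite scaler0 addr0 scaleN1r addNr.
have f0a : f0 a != 0.
  apply: contra_neq lf0 => f0a; apply: lD => u; rewrite inE => /orP[/eqP ->//|].
  exact: f0D.
pose c := l f0 / f0 a.
have [||u hu] := IH (fun f => l f - c * f a).
- move=> x f g; rewrite ll blinD blinZ /GRing.scale /=; ring.
- move=> f fD; have : l (f - (f a / f0 a) *: f0) = 0.
    apply: lD => u; rewrite inE blinB blinZ => /orP[/eqP ->|uD].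
      by rewrite /GRing.scale /= divfK// subrr.
    by rewrite (fD u uD) (f0D u uD) scaler0 subr0.
  have -> : f - (f a / f0 a) *: f0 = - (f a / f0 a) *: f0 + f by rewrite scaleNr addrC.
  rewrite ll /GRing.scale /= => h; rewrite -[RHS]h /c; ring.
- exists (u + c *: a) => f.
  have -> : f (u + c *: a) = f u + c * f a by rewrite linearD linearZ.
  by rewrite -(hu f) /= subrK.
Qed.

(** The filter generated by the sets of functionals that are small at finitely many
    vectors converges to zero pointwise, hence weak*.  So continuity makes the functional
    at most 1 on one such set; by homogeneity it vanishes where those finitely many
    evaluations do, and is therefore a combination of them. *)
Lemma weak_star_functional U V (L : dual U -> dual V) (v : V) :
  linear L -> weak_star_continuous L -> exists u, forall f : dual U, L f v = f u.
Proof.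
move=> lL cL; have L0 : L 0 = 0 by have := lL (-1) 0 0; rewrite scaler0 addr0 scaleN1r addNr.
pose B (p : seq U * R) := [set f : dual U | forall u, u \in p.1 -> rnorm (f u) <= p.2].
pose F := filter_from [set p : seq U * R | 0 < p.2] B.
have FF : Filter F.
  apply: filter_from_filter; first by exists ([::], 1); exact: ltr01.
  move=> [r1 d1] [r2 d2] /= d10 d20; exists (r1 ++ r2, Num.min d1 d2).
    by rewrite /= lt_min d10.
  move=> f /= fB; split=> u ur; have := fB u; rewrite mem_cat ur ?orbT => /(_ isT);
    by rewrite le_min => /andP[].
have F0 : F --> (0 : weak_star U).
  apply/(@weak_star_cvgP _ F 0) => u; apply/(@cvg_rnormP R k K^o) => e e0.
  exists ([:: u], e) => // f /= /(_ u); rewrite inE eqxx => /(_ isT).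
  by rewrite sub0r rnormN.
have LF : L @ F --> (0 : weak_star V).
  have := cL 0; rewrite /continuous_at L0; apply: cvg_trans; exact: cvg_app.
have := (@weak_star_cvgP V (L @ F) 0 (fmap_filter L FF)).1 LF v.
move=> /(@cvg_rnormP R k K^o)/(_ 1 ltr01)[[D d] /= d0 hD].
apply: (@kernel_functional _ D (fun f => L f v)).
  by move=> a f g; rewrite lL blinD blinZ.
move=> f fD; apply: (@rnorm_eq0_small _ _ _ _ 1) => // e e0; rewrite mul1r.
(* Scaling f by 1 / e stays in the neighbourhood, as f vanishes on D. *)
have := hD (ofR e^-1 *: f).
have lZ : L (ofR e^-1 *: f) = ofR e^-1 *: L f.
  by have := lL (ofR e^-1) f 0; rewrite L0 !addr0.
rewrite /= lZ blinZ sub0r rnormN rnormZ rnorm_ofR gtr0_norm ?invr_gt0//.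
rewrite mulrC ler_pdivrMr// mul1r; apply.
by move=> u uD; rewrite blinZ fD// scaler0 rnorm0 ltW.
Qed.

End weak_star_functionals.

Section bilinear.
Context {R : realType} {k : scalar_kind}.
Local Notation K := (scalars R k).

Lemma bilinear_blin (X V : normedModType K) (b : X -> V -> K^o) (M : R) :
  (forall v, linear (b^~ v)) -> (forall x, linear (b x)) ->
  (forall x v, rnorm (b x v) <= M * rnorm x * rnorm v) ->
  exists A : blin X (dual V), forall x v, A x v = b x v.
Proof.
move=> bl br bM.
have /choice[A0 hA0] x : exists f : dual V, forall v, f v = b x v.
  by exists (Blin (blinP (br x) (bM x))).
have lA : linear A0.
  by move=> a x y; apply: blinE => v; rewrite blinD blinZ !hA0; exact: bl.
have bA x : rnorm (A0 x) <= (Num.max M 0) * rnorm x.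
  apply: rnorm_blin_lub; first by rewrite mulr_ge0 ?rnorm_ge0// le_max lexx orbT.
  move=> v; rewrite hA0 (le_trans (bM x v))// !ler_wpM2r ?rnorm_ge0//.
  by rewrite le_max lexx.
by exists (Blin (blinP lA bA)).
Qed.

Lemma rnorm_bilinear_lub (X V : normedModType K) (A : blin X (dual V)) (M : R) :
  0 <= M -> (forall x v, rnorm (A x v) <= M * rnorm x * rnorm v) -> rnorm A <= M.
Proof.
move=> M0 AM; apply: rnorm_blin_lub => // x; apply: rnorm_blin_lub => [|v].
  by rewrite mulr_ge0// rnorm_ge0.
exact: AM.
Qed.

Lemma rnorm_bilinear_le (X V : normedModType K) (A : blin X (dual V)) x v :
  rnorm (A x v) <= rnorm A * rnorm x * rnorm v.
Proof.
apply: le_trans (rnorm_blin_le (A x) v) _.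
by rewrite ler_wpM2r ?rnorm_ge0// rnorm_blin_le.
Qed.

End bilinear.

Section projective_pairing.
Context {R : realType} {k : scalar_kind}.
Local Notation K := (scalars R k).
Variables X V : normedModType K.
Implicit Types (A B : blin X (dual V)) (w : formal_tensor X V).

Definition pair_formal A w : K^o := tensor_apply (fun x v => A x v) w.

Lemma pair_formalD A B w : pair_formal (A + B) w = pair_formal A w + pair_formal B w.
Proof. by rewrite /pair_formal /tensor_apply -big_split. Qed.

Lemma pair_formal_sub A u w :
  pair_formal A (tensor_sub u w) = pair_formal A u - pair_formal A w.
Proof.
rewrite /pair_formal /tensor_apply /tensor_sub big_cat big_map /= -sumrN.
by congr (_ + _); apply: eq_bigr => p _; rewrite linearN.
Qed.

(** The pairing depends only on the tensor, so each representation of it as a formal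
    sum gives a bound, and the projective norm is their infimum. *)
Lemma pair_formal_le A w : rnorm (pair_formal A w) <= rnorm A * projective_norm w.
Proof.
apply: (@ler_addmul_gt0 _ _ _ (rnorm A)) => [|e e0]; first exact: rnorm_ge0.
set S := [set \sum_(p <- w') rnorm p.1 * rnorm p.2 | w' in same_tensor w].
have infS : has_inf S.
  split; first by exists (\sum_(p <- w) rnorm p.1 * rnorm p.2), w.
  by exists 0 => _ [w' _ <-]; apply: sumr_ge0 => p _; rewrite mulr_ge0 ?rnorm_ge0.
have [_ [w' ww' <-] he] := inf_adherent e0 infS.
have -> : pair_formal A w = pair_formal A w'.
  apply: (ww' (fun x v => A x v)) => [v a x y|x].
    by rewrite linearP.
  exact: blin_linear.
rewrite [e * _]mulrC -mulrDr.
apply: (@le_trans _ _ (rnorm A * \sum_(p <- w') rnorm p.1 * rnorm p.2)); last first.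
  by rewrite ler_wpM2l ?rnorm_ge0//; exact: ltW he.
apply: le_trans (rnorm_sum _ _ _) _; rewrite mulr_sumr; apply: ler_sum => p _.
by rewrite mulrA rnorm_bilinear_le.
Qed.

Lemma tensor_pairing_cvg (u : projective_tensor X V) A :
  pair_formal A (tensor_seq u n) @[n --> \oo] --> tensor_pairing u A.
Proof.
have [|l hl] := @banach_scalars R k (fun n => pair_formal A (tensor_seq u n)).
  move=> e e0; have A1 : 0 < rnorm A + 1 by rewrite ltr_wpDl ?rnorm_ge0.
  have [N hN] := tensor_seq_cauchy u (divr_gt0 e0 A1).
  exists N => i j Ni Nj; rewrite -pair_formal_sub.
  have h := hN i j Ni Nj; apply: le_trans (pair_formal_le _ _) _.
  apply: (@le_trans _ _ (rnorm A * (e / (rnorm A + 1)))).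
    by rewrite ler_wpM2l ?rnorm_ge0// ltW.
  rewrite mulrA ler_pdivrMr// mulrC ler_wpM2l ?(ltW e0)//.
  by rewrite lerDl.
rewrite /tensor_pairing (cvg_lim _ hl)//; exact: norm_hausdorff.
Qed.

Lemma tensor_pairingD u A B :
  tensor_pairing u (A + B) = tensor_pairing u A + tensor_pairing u B.
Proof.
apply: (cvgn_unique (@tensor_pairing_cvg u (A + B))).
have -> : (fun n => pair_formal (A + B) (tensor_seq u n)) =
    (fun n => pair_formal A (tensor_seq u n) + pair_formal B (tensor_seq u n)).
  by apply/funext => n; exact: pair_formalD.
by apply: cvgD; exact: tensor_pairing_cvg.
Qed.

Lemma tensor_pairing0 (u : projective_tensor X V) : tensor_pairing u 0 = 0.
Proof.
by have := tensor_pairingD u 0 0; rewrite addr0 => /eqP; rewrite -subr_eq subrr => /eqP.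
Qed.

Lemma tensor_pairingB u A B :
  tensor_pairing u (A - B) = tensor_pairing u A - tensor_pairing u B.
Proof. by rewrite -{2}(subrK B A) (tensor_pairingD u (A - B) B) addrK. Qed.

Lemma tensor_pairing_sum u (I : Type) (r : seq I) (F : I -> blin X (dual V)) :
  tensor_pairing u (\sum_(i <- r) F i) = \sum_(i <- r) tensor_pairing u (F i).
Proof. exact: (big_morph _ (tensor_pairingD u) (tensor_pairing0 u)). Qed.

(** One finite sum serves for all operators at once, up to their norm. *)
Lemma tensor_pairing_approx (u : projective_tensor X V) (e : R) : 0 < e ->
  exists w, forall A, rnorm (tensor_pairing u A - pair_formal A w) <= e * rnorm A.
Proof.
move=> e0; have [N hN] := tensor_seq_cauchy u e0; exists (tensor_seq u N) => A.
rewrite rnorm_distC; apply: (rnorm_lim (@tensor_pairing_cvg u A)).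
exists N => // n /= Nn; rewrite -pair_formal_sub mulrC.
apply: le_trans (pair_formal_le _ _) _; rewrite ler_wpM2l ?rnorm_ge0//.
by apply/ltW/hN.
Qed.

Lemma pair_formal_vanish (A_ : nat -> blin X (dual V)) w :
  (forall x v, A_ n x v @[n --> \oo] --> (0 : K^o)) ->
  pair_formal (A_ n) w @[n --> \oo] --> (0 : K^o).
Proof.
move=> h; elim: w => [|[x v] w IH].
  rewrite (_ : (fun n => _) = (fun=> 0)); first exact: cvg_cst.
  by apply/funext => n; rewrite /pair_formal /tensor_apply big_nil.
rewrite (_ : (fun n => _) = (fun n => A_ n x v + pair_formal (A_ n) w)); last first.
  by apply/funext => n; rewrite /pair_formal /tensor_apply big_cons.
by rewrite -[X in _ --> X]addr0; apply: cvgD (h x v) IH.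
Qed.

(** The remainders of the series are values of $m$ at Borel sets, hence bounded, and
    converge to zero at each pair of vectors. *)
Lemma weak_star_countably_additiveP (T : topologicalType) (m : set T -> blin X (dual V)) :
  bounded_vector_measure m ->
  (forall x v, countably_additive (fun E => m E x v : K^o)) ->
  weak_star_countably_additive m.
Proof.
move=> [am mf] ca u E bE tE; have mM := semivariation_fine mf.
set M := fine _ in mM; have nM : (semivariation m <= M%:E)%E by rewrite -mM.
have M0 := semivariation_bound_ge0 nM.
pose D n := m (\bigcup_i E i) - \sum_(i <- iota 0 n) m (E i).
have bU n : borel (\bigcup_(i in [set` iota 0 n]) E i) by exact: borel_bigcup_seq.
have DE n : D n = m (\bigcup_i E i `\` \bigcup_(i in [set` iota 0 n]) E i).
  rewrite (vector_measureD am (borel_bigcup bE) (bU n)).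
    by rewrite (vector_measure_seq am (iota_uniq 0 n) bE tE).
  by move=> x [i _ ?]; exists i.
have DM n : rnorm (D n) <= M.
  by rewrite DE; apply: (measure_le am nM); apply: borelD => //; exact: borel_bigcup.
have Dxv x v : D n x v @[n --> \oo] --> (0 : K^o).
  have := ca x v E bE tE; set l := m (\bigcup_n E n) x v => h.
  rewrite (_ : (fun n => _) = (fun n => l - series (fun n => m (E n) x v : K^o) n)).
    by rewrite -(subrr l); apply: cvgB => //; exact: cvg_cst.
  apply/funext => n; rewrite /D !blinB /series /= /index_iota subn0.
  by rewrite (blin_sum (iota 0 n)) (blin_sum (iota 0 n)).
apply/(@cvgn_rnormP R k K^o) => e e0.
have M1 : 0 < M + 1 by rewrite ltr_wpDl.
have [w hw] := tensor_pairing_approx u (divr_gt0 (divr_gt0 e0 M1) (ltr0Sn _ 1)).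
have /cvgn_rnormP/(_ _ (divr_gt0 e0 (ltr0Sn _ 1)))[N hN] := pair_formal_vanish w Dxv.
exists N => n /hN; rewrite sub0r rnormN => h.
rewrite /series /= /index_iota subn0 -tensor_pairing_sum -tensor_pairingB -/(D n).
apply: le_trans (rnorm_le_dist _ (pair_formal (D n) w)) _.
rewrite [leRHS]splitr lerD//; apply: le_trans (hw (D n)) _.
rewrite mulrAC ler_pM2r ?invr_gt0// mulrAC ler_pdivrMr// ler_wpM2l ?(ltW e0)//.
by apply: le_trans (DM n) _; rewrite lerDl.
Qed.

End projective_pairing.

(** * Operators on continuous functions and their representing measures *)

Section borel_values.
Context {R : realType} {k : scalar_kind} {T : topologicalType}.
Local Notation K := (scalars R k).

Lemma semivariation_eq_borel (Z : normedModType K) (m m' : set T -> Z) :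
  (forall E, borel E -> m E = m' E) -> semivariation m = semivariation m'.
Proof.
suff le (n n' : set T -> Z) : (forall E, borel E -> n E = n' E) ->
    (semivariation n <= semivariation n')%E.
  by move=> mm'; apply/eqP; rewrite eq_le !le// => E bE; rewrite mm'.
move=> nn'; apply: ge_ereal_sup => _ [i [E [eps [bE tE cE e1 ->]]]].
apply: ereal_sup_ubound; exists i, E, eps; split=> //; congr (rnorm _)%:E.
by apply: eq_bigr => j _; rewrite nn'.
Qed.

Lemma regular_eq_borel (mu nu : set T -> K^o) :
  (forall E, borel E -> mu E = nu E) -> regular mu -> regular nu.
Proof.
move=> mn rm E bE e /(rm E bE)[F [G [cF oG FE EG h]]]; exists F, G; split=> // B bB.
by rewrite -mn//; exact: h.
Qed.

Lemma countably_additive_eq_borel (mu nu : set T -> K^o) :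
  (forall E, borel E -> mu E = nu E) -> countably_additive mu -> countably_additive nu.
Proof.
move=> mn ca E bE tE; have := ca E bE tE.
rewrite mn; last exact: borel_bigcup.
by rewrite (_ : (fun n => mu (E n)) = (fun n => nu (E n)))//; apply/funext => n; rewrite mn.
Qed.

Lemma simple_integral_eq_borel (Z : normedModType K) (m m' : set T -> Z) s :
  (forall E, borel E -> m E = m' E) -> borel_simple s ->
  simple_integral m s = simple_integral m' s.
Proof. by move=> mm' [_ bs]; apply: eq_fsbigr => a _; rewrite mm'. Qed.

End borel_values.

Section composition.
Context {R : realType} {k : scalar_kind} {T : topologicalType}.
Local Notation K := (scalars R k).
Variables (Z Z' : normedModType K) (A : blin Z Z') (m : set T -> Z).

Lemma vector_measure_comp : vector_measure m -> vector_measure (fun E => A (m E)).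
Proof. by move=> am E F bE bF EF; rewrite am// linearD. Qed.

Lemma semivariation_comp (M : R) : (semivariation m <= M%:E)%E ->
  (semivariation (fun E => A (m E)) <= (rnorm A * M)%:E)%E.
Proof.
move=> mM; apply: ge_ereal_sup => _ [n [E [eps [bE tE cE e1 ->]]]]; rewrite lee_fin.
have -> : \sum_(i < n) eps i *: A (m (E i)) = A (\sum_(i < n) eps i *: m (E i)).
  by rewrite linear_sum; apply: eq_bigr => i _; rewrite linearZ.
apply: le_trans (rnorm_blin_le _ _) _; rewrite ler_wpM2l ?rnorm_ge0// -lee_fin.
by apply: le_trans mM; apply: ereal_sup_ubound; exists n, E, eps.
Qed.

Lemma bounded_vector_measure_comp :
  bounded_vector_measure m -> bounded_vector_measure (fun E => A (m E)).
Proof.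
move=> [am mf]; split; first exact: vector_measure_comp.
apply: le_lt_trans (semivariation_comp (M := fine (semivariation m)) _) (ltry _).
by rewrite -semivariation_fine.
Qed.

Lemma simple_integral_comp s : vector_measure m -> borel_simple s ->
  simple_integral (fun E => A (m E)) s = A (simple_integral m s).
Proof.
move=> am /borel_simple_step[I [E [c [pE sE]]]].
rewrite (simple_integral_step am pE sE).
rewrite (simple_integral_step (vector_measure_comp am) pE sE) linear_sum.
by apply: eq_bigr => i _; rewrite linearZ.
Qed.

Lemma vintegral_comp f : banach Z -> bounded_vector_measure m -> approximable f ->
  vintegral (fun E => A (m E)) f = A (vintegral m f).
Proof.
move=> bZ [am mf] af.
have mM : (semivariation m <= (fine (semivariation m))%:E)%E by rewrite -semivariation_fine.
apply: (vintegral_eq (semivariation_comp mM) af) => d s d0 ss fs.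
rewrite simple_integral_comp// -linearB; apply: le_trans (rnorm_blin_le _ _) _.
rewrite mulrCA ler_wpM2l ?rnorm_ge0//.
exact: (vintegral_value am mM bZ af).
Qed.

End composition.

Lemma rnorm_vintegral_le (R : realType) (k : scalar_kind) (T : topologicalType)
    (Z : normedModType (scalars R k)) (m : set T -> Z) (f : T -> scalars R k) (M d : R) :
  banach Z -> vector_measure m -> (semivariation m <= M%:E)%E -> approximable f ->
  (forall x, rnorm (f x : (scalars R k)^o) <= d) -> 0 <= d ->
  rnorm (vintegral m f) <= d * M.
Proof.
move=> bZ am mM af fd d0.
have p1 : borel_partition (fun _ : unit => [set: T]).
  split=> [_|[] []//|x]; [exact: borelT|by exists tt].
have s0 : step_function (fun _ : unit => [set: T]) (fun=> 0 : scalars R k) (fun=> 0) by [].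
apply: (@ler_addmul_gt0 _ _ _ M); first exact: semivariation_bound_ge0 mM.
move=> e e0; have de : 0 < d + e by rewrite ltr_wpDl.
have := vintegral_value am mM bZ af de (step_borel_simple p1 s0).
rewrite (simple_integral_step am p1 s0) big1 ?subr0 => [|i _]; last by rewrite scale0r.
rewrite mulrDl; apply=> x; rewrite subr0; apply: le_trans (fd x) _.
by rewrite lerDl ltW.
Qed.

Section representing_operators.
Context {R : realType} {k : scalar_kind}.
Local Notation K := (scalars R k).
Variables (X Y : normedModType K) (T : topologicalType).
Variable cT : compact [set: T].
Hypothesis hT : hausdorff_space T.
Local Notation C := (continuous_fun R k cT).
Local Notation D2 := (blin X (dual (dual Y))).
Implicit Types (S : blin C (blin X Y)) (m : set T -> D2).

Definition eval2 (x : X) (y' : dual Y) : blin D2 K^o :=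
  blin_comp (eval_at K^o y') (eval_at (dual (dual Y)) x).

Lemma banach_operators : banach D2.
Proof. by do 2!apply: banach_blin; exact: banach_scalars. Qed.

Lemma adjoint_operator_atE S x y' f : adjoint (operator_at S x) y' f = y' (S f x).
Proof. by []. Qed.

Lemma rnorm_adjoint_le S x y' :
  rnorm (adjoint (operator_at S x) y') <= rnorm S * rnorm x * rnorm y'.
Proof.
apply: rnorm_blin_lub; first by rewrite !mulr_ge0 ?rnorm_ge0.
move=> f; rewrite adjoint_operator_atE.
apply: le_trans (rnorm_blin_le y' (S f x)) _.
rewrite mulrC mulrAC ler_wpM2r ?rnorm_ge0// mulrAC.
apply: le_trans (rnorm_blin_le (S f) x) _.
by rewrite ler_wpM2r ?rnorm_ge0// rnorm_blin_le.
Qed.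

Lemma semivariation_bilinear_le m (M : R) : 0 <= M ->
  (forall x y', (semivariation (scalar_measure m x y') <=
                 (M * rnorm x * rnorm y')%:E)%E) ->
  (semivariation m <= M%:E)%E.
Proof.
move=> M0 h; apply: ge_ereal_sup => _ [n [E [eps [bE tE cE e1 ->]]]]; rewrite lee_fin.
apply: rnorm_bilinear_lub => // x y'; rewrite -lee_fin; apply: le_trans (h x y').
apply: ereal_sup_ubound; exists n, E, eps; split=> //; congr (rnorm _)%:E.
have -> : (\sum_(i < n) eps i *: m (E i)) x y' =
    eval2 x y' (\sum_(i < n) eps i *: m (E i)) by [].
by rewrite linear_sum; apply: eq_bigr => i _; rewrite linearZ.
Qed.

(** Linearity in each variable comes from uniqueness of the Riesz measure.  Off the
    Borel sets the value is arbitrary. *)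
Lemma exists_operator_measure S : exists m, forall E, borel E -> forall x y',
  m E x y' = riesz_measure hT (adjoint (operator_at S x) y') E.
Proof.
suff ex E : exists A : D2, borel E -> forall x y',
    A x y' = riesz_measure hT (adjoint (operator_at S x) y') E.
  by have [m hm] := choice ex; exists m.
have [bE|nbE] := pselect (borel E); last by exists 0 => /nbE.
have rep x y' := riesz_represents hT (adjoint (operator_at S x) y').
have [|||A hA] := @bilinear_blin R k X (dual Y)
  (fun x y' => riesz_measure hT (adjoint (operator_at S x) y') E) (rnorm S).
- move=> y' a u v; apply: (represents_linear hT (rep _ _) (rep _ _) (rep _ _)) => // f.
  by rewrite !adjoint_operator_atE !linearP.
- move=> x a u v; apply: (represents_linear hT (rep _ _) (rep _ _) (rep _ _)) => // f.
- move=> x y'; apply: le_trans (rnorm_adjoint_le S x y').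
  by apply: measure_le bE; [exact: riesz_measure_additive|exact: riesz_measure_semivariation].
by exists A.
Qed.

Lemma vector_measure_bilinear m :
  (forall x y', vector_measure (scalar_measure m x y')) -> vector_measure m.
Proof.
move=> h A B bA bB AB; apply: blinE => x; apply: blinE => y'.
exact: (h x y' A B bA bB AB).
Qed.

Lemma representing_measure_exists S : exists m, representing_measure S m.
Proof.
have [m hm] := exists_operator_measure S; exists m.
pose L x y' := adjoint (operator_at S x) y'.
have am : vector_measure m.
  apply: vector_measure_bilinear => x y' A B bA bB AB.
  rewrite /scalar_measure !hm//; last exact: borelU.
  exact: riesz_measure_additive.
have nm x y' : (semivariation (scalar_measure m x y') <= (rnorm (L x y'))%:E)%E.
  rewrite (semivariation_eq_borel (m' := riesz_measure hT (L x y'))); last first.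
    by move=> E bE; exact: hm.
  exact: riesz_measure_semivariation.
have mS : (semivariation m <= (rnorm S)%:E)%E.
  apply: semivariation_bilinear_le => [|x y']; first exact: rnorm_ge0.
  by apply: le_trans (nm x y') _; rewrite lee_fin rnorm_adjoint_le.
split; first by split=> //; exact: le_lt_trans mS (ltry _).
  move=> x y'; apply: (@regular_eq_borel _ _ _ (riesz_measure hT (L x y'))).
    by move=> E bE; rewrite /scalar_measure hm.
  exact: riesz_measure_regular.
move=> f; apply/esym/(vintegral_eq mS (approximable_cfun f)) => d s d0 ss fs.
apply: rnorm_bilinear_lub => [|x y'].
  by rewrite mulr_ge0 ?rnorm_ge0// ltW.
(* Both sides are tested on x and y', where the Riesz measure takes over. *)
have -> : (blin_comp (to_bidual Y) (S f) - simple_integral m s) x y' =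
    L x y' f - simple_integral (riesz_measure hT (L x y')) s.
  rewrite !blinB -(simple_integral_comp (eval2 x y') am ss : _ = simple_integral m s x y').
  congr (_ - _); apply: simple_integral_eq_borel => // E bE; exact: hm.
apply: le_trans (@riesz_measure_integral R k T cT hT (L x y') f d s d0 ss fs) _.
by rewrite -!mulrA ler_wpM2l ?(ltW d0)// mulrA rnorm_adjoint_le.
Qed.

Section represented.
Variables (S : blin C (blin X Y)) (m : set T -> D2).
Hypothesis Sm : representing_measure S m.

Lemma vintegral_at (x : X) (f : C) :
  vintegral (measure_at m x) f = vintegral m f x.
Proof.
have [bm _ _] := Sm.
exact: (vintegral_comp (eval_at (dual (dual Y)) x) banach_operators bm (approximable_cfun f)).
Qed.

Lemma scalar_measure_represents x y' :
  represents (scalar_measure m x y') (adjoint (operator_at S x) y').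
Proof.
have [bm rm Sf] := Sm; have [am' mf'] := bounded_vector_measure_comp (eval2 x y') bm.
split=> // f; rewrite adjoint_operator_atE.
rewrite (vintegral_comp (eval2 x y') banach_operators bm (approximable_cfun f)).
by rewrite -Sf.
Qed.

Lemma scalar_measure_riesz x y' E : borel E ->
  scalar_measure m x y' E = riesz_measure hT (adjoint (operator_at S x) y') E.
Proof.
move=> bE; apply: (represents_unique hT (scalar_measure_represents x y')) => //.
exact: riesz_represents.
Qed.

Lemma classical_representing_measure_at x :
  classical_representing_measure (operator_at S x) (measure_at m x).
Proof.
have [bm rm Sf] := Sm; split.
- exact: (bounded_vector_measure_comp (eval_at (dual (dual Y)) x) bm).
- exact: rm.
- by move=> f; rewrite vintegral_at -Sf.
Qed.

Lemma scalar_measure_is_functional x y' :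
  measure_is_functional (scalar_measure m x y') (adjoint (operator_at S x) y').
Proof.
have [_ _ rm Lf] := scalar_measure_represents x y'; split=> //.
apply: (@countably_additive_eq_borel R k T
  (riesz_measure hT (adjoint (operator_at S x) y'))); last first.
  exact: riesz_measure_countably_additive.
by move=> E bE; rewrite scalar_measure_riesz.
Qed.

Lemma representing_measure_norm : (rnorm S)%:E = semivariation m.
Proof.
have [[am mf] rm Sf] := Sm.
have mM : (semivariation m <= (fine (semivariation m))%:E)%E by rewrite -semivariation_fine.
apply/eqP; rewrite eq_le; apply/andP; split.
  rewrite semivariation_fine// lee_fin.
  apply: rnorm_blin_lub; first exact: semivariation_bound_ge0 mM.
  move=> f; apply: (@le_trans _ _ (rnorm (blin_comp (to_bidual Y) (S f)))).
    apply: rnorm_blin_lub => [|x]; first exact: rnorm_ge0.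
    rewrite -rnorm_to_bidual.
    exact: (rnorm_blin_le (blin_comp (to_bidual Y) (S f)) x).
  rewrite Sf mulrC; apply: rnorm_vintegral_le => //.
  - exact: banach_operators.
  - exact: approximable_cfun.
  - by move=> x; exact: rnorm_cfun_ub.
  - exact: rnorm_ge0.
apply: semivariation_bilinear_le => [|x y']; first exact: rnorm_ge0.
rewrite (semivariation_eq_borel (@scalar_measure_riesz x y')).
apply: le_trans (riesz_measure_semivariation hT _) _.
by rewrite lee_fin rnorm_adjoint_le.
Qed.

Lemma representing_measure_weak_star_countably_additive :
  weak_star_countably_additive m.
Proof.
have [bm _ _] := Sm; apply: weak_star_countably_additiveP => // x y'.
by have [] := scalar_measure_is_functional x y'.
Qed.

Lemma adjoint_weak_star_continuous x :
  exists L : blin (dual Y) (dual C),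
    (forall y', measure_is_functional (scalar_measure m x y') (L y')) /\
    weak_star_continuous L.
Proof.
have ll : linear (adjoint (operator_at S x)) by move=> a u v; exact: blinE.
exists (Blin (blinP ll (rnorm_adjoint_le S x))); split.
  by move=> y'; exact: scalar_measure_is_functional.
move=> y'; have nF : Filter (nbhs (y' : weak_star Y)) by exact: nbhs_filter.
apply/(@weak_star_cvgP R k C _ _ (fmap_filter _ nF)) => f.
exact: ((@weak_star_cvgP R k Y _ y' nF).1 (@cvg_id _ _) (S f x)).
Qed.

End represented.

Lemma representing_measure_unique S m m' :
  representing_measure S m -> representing_measure S m' ->
  forall E, borel E -> m' E = m E.
Proof.
move=> Sm Sm' E bE; apply: blinE => x; apply: blinE => y'.
have := scalar_measure_riesz Sm x y' bE; have := scalar_measure_riesz Sm' x y' bE.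
by rewrite /scalar_measure => -> ->.
Qed.

(** The vector $S f x$ is the one that represents the weak*-continuous functional
    $y' \mapsto \int f\,d\mu_{x,y'}$; it is unique because functionals separate the points of
    $Y$, which gives linearity in $f$ and $x$. *)
Lemma operator_of_weak_star_functionals m : bounded_vector_measure m ->
  (forall x, exists L : blin (dual Y) (dual C),
    (forall y', measure_is_functional (scalar_measure m x y') (L y')) /\
    weak_star_continuous L) ->
  exists S : blin C (blin X Y), representing_measure S m.
Proof.
move=> bm /choice[L hL]; have [am mf] := bm.
have mM : (semivariation m <= (fine (semivariation m))%:E)%E by rewrite -semivariation_fine.
set M := fine _ in mM.
have LE x y' f : L x y' f = vintegral m f x y'.
  have [/(_ y')[_ _ ->] _] := hL x.
  by rewrite (vintegral_comp (eval2 x y') banach_operators bm (approximable_cfun f)).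
(* The vectors are chosen for all pairs (f, x) at once. *)
have /choice[s0 hs0] (p : C * X) : exists y, forall y' : dual Y, L p.2 y' p.1 = y' y.
  by apply: weak_star_functional; [exact: blin_linear|have [] := hL p.2].
pose s f x := s0 (f, x).
have sE f x (y' : dual Y) : y' (s f x) = vintegral m f x y'.
  by rewrite -(hs0 (f, x) y') LE.
have sL f x (y' : dual Y) : y' (s f x) = L x y' f by rewrite sE LE.
have sB f x : to_bidual Y (s f x) = vintegral m f x by apply: blinE => y'; exact: sE.
have ls f : linear (s f).
  move=> a u v; apply: to_bidual_inj => y'.
  have -> : y' (a *: s f u + s f v) = a *: y' (s f u) + y' (s f v) by exact: linearP.
  by rewrite !sE linearP.
have bs f x : rnorm (s f x) <= rnorm (vintegral m f) * rnorm x.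
  by rewrite -rnorm_to_bidual sB; exact: rnorm_blin_le.
pose S0 f : blin X Y := Blin (blinP (ls f) (bs f)).
have lS : linear S0.
  move=> a f g; apply: blinE => x; apply: to_bidual_inj => y'.
  have -> : y' ((a *: S0 f + S0 g) x) = a *: y' (s f x) + y' (s g x).
    exact: (linearP y' a (s f x) (s g x)).
  by rewrite !sL linearP.
have bS f : rnorm (S0 f) <= M * rnorm f.
  apply: (@le_trans _ _ (rnorm (vintegral m f))).
    by apply: rnorm_blin_lub => [|x]; [exact: rnorm_ge0|exact: bs].
  rewrite mulrC; apply: rnorm_vintegral_le => //.
  - exact: banach_operators.
  - exact: approximable_cfun.
  - by move=> x; exact: rnorm_cfun_ub.
  - exact: rnorm_ge0.
exists (Blin (blinP lS bS)); split=> //.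
  by move=> x y'; have [/(_ y')[]] := hL x.
by move=> f; apply: blinE => x; exact: sB.
Qed.

End representing_operators.

Theorem theorem2p4 (R : realType) (k : scalar_kind)
    (X Y : completeNormedModType (scalars R k))
    (Omega : topologicalType) (Omega_compact : compact [set: Omega])
    (Omega_hausdorff : hausdorff_space Omega) :
  (forall S : blin (continuous_fun R k Omega_compact) (blin X Y),
    exists m : set Omega -> blin X (dual (dual Y)),
      representing_measure S m /\
      forall m' : set Omega -> blin X (dual (dual Y)),
        representing_measure S m' -> forall E, borel E -> m' E = m E) /\
  (forall m : set Omega -> blin X (dual (dual Y)), bounded_vector_measure m ->
    ((exists S : blin (continuous_fun R k Omega_compact) (blin X Y),
        representing_measure S m) <->
     (forall x : X,
        exists L : blin (dual Y) (dual (continuous_fun R k Omega_compact)),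
          (forall y' : dual Y,
             measure_is_functional (scalar_measure m x y') (L y')) /\
          weak_star_continuous L)) /\
    (forall S : blin (continuous_fun R k Omega_compact) (blin X Y),
      representing_measure S m ->
      [/\ forall x : X,
            classical_representing_measure (operator_at S x) (measure_at m x),
          forall (x : X) (y' : dual Y),
            measure_is_functional (scalar_measure m x y')
              (adjoint (operator_at S x) y'),
          (rnorm S)%:E = semivariation m &
          weak_star_countably_additive m])).

Proof.
split=> [S|m bm].
  have [m Sm] := representing_measure_exists Omega_hausdorff S.
  by exists m; split=> // m'; exact: (representing_measure_unique Omega_hausdorff Sm).
split; first split.
- move=> [S Sm] x; exact: (adjoint_weak_star_continuous Omega_hausdorff Sm).
- exact: operator_of_weak_star_functionals.
- move=> S Sm; split.
  + exact: classical_representing_measure_at Sm.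
  + exact: (scalar_measure_is_functional Omega_hausdorff Sm).
  + exact: (representing_measure_norm Omega_hausdorff Sm).
  + exact: (representing_measure_weak_star_countably_additive Omega_hausdorff Sm).
Qed.
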